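(* Let $(\tilde L,\tilde\alpha,\tilde\pi,[,],D)$ be a $\mathrm D$-Lie algebra and let $(\rho,E)$ be an $\tilde L$-connection with $\rho(D)=Id_E$. There is a canonical map $$\rho^!:\mathrm{End}(\tilde L,E)\to\mathrm{Diff}^1(E),\qquad \rho^!(\phi,u)=\phi+\rho(u),$$ and $\rho^!$ is a map of $A\otimes_kA$-modules and $k$-Lie algebras. The map $\rho^!$ induces a map of associative rings $T(\rho^!):\tilde U^{\otimes}(\mathrm{End}(\tilde L,E))\to\mathrm{Diff}(E)$. Let $\tilde U^{\otimes}(\tilde L,\rho):=\mathrm{Im}(T(\rho^!))$. There is an exact sequence $$0\to\ker(T(\rho^!))\to\tilde U^{\otimes}(\mathrm{End}(\tilde L,E))\to\tilde U^{\otimes}(\tilde L,\rho)\to0.$$ The rings $\tilde U^{\otimes}(\mathrm{End}(\tilde L,E))$ and $\tilde U^{\otimes}(\tilde L,\rho)$ are almost commutative. If $A$ is Noetherian and $\tilde L$ and $E$ are finitely generated as left $A$-modules, then $\tilde U^{\otimes}(\mathrm{End}(\tilde L,E))$ and $\tilde U^{\otimes}(\tilde L,\rho)$ are Noetherian rings.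
   Context: Let $k\to A$ be a unital homomorphism of commutative unital rings. An $A\otimes_kA$-module $M$ is regarded as having commuting left and right actions $am=(a\otimes 1)m$, $ma=(1\otimes a)m$. A 2-cocycle $f\in Z^2(\mathrm{Der}_k(A),A)$ is an alternating $A$-bilinear map with $x(f(y,z))-y(f(x,z))+z(f(x,y))-f([x,y],z)+f([x,z],y)-f([y,z],x)=0$. For such a fixed $f$, $D^1_f(A)=A\oplus\mathrm{Der}_k(A)$, with elements $aI+x$, has actions $c(aI+x)=(ca)I+cx$, $(aI+x)c=(ac+x(c))I+cx$, bracket $[aI+x,bI+y]=(x(b)-y(a)+f(x,y))I+[x,y]$, and projection $\pi(aI+x)=x$. $\mathrm{Der}_k(A)$ carries the trivial right $A$-module structure (right action equal to left action). A $\mathrm D$-Lie algebra is a 5-tuple $(\tilde L,\tilde\alpha,\tilde\pi,[,],D)$ where $\tilde L$ is an $A\otimes_kA$-module and a $k$-Lie algebra, $\tilde\alpha:\tilde L\to D^1_f(A)$ and $\tilde\pi:\tilde L\to\mathrm{Der}_k(A)$ are maps of $A\otimes_kA$-modules and $k$-Lie algebras with $\pi\circ\tilde\alpha=\tilde\pi$, $D\in\tilde L$ is central for the Lie bracket, $\tilde\pi(D)=0$, and for all $u,v\in\tilde L$, $c\in A$: $uc=cu+\tilde\pi(u)(c)D$ and $[u,cv]=c[u,v]+\tilde\pi(u)(c)v$. For a left $A$-module $E$, $\mathrm{End}_k(E)$ is the $A\otimes_kA$-module with $(a\psi)(e)=a\psi(e)$, $(\psi a)(e)=\psi(ae)$.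 An $\tilde L$-connection $(\rho,E)$ is an $A\otimes_kA$-linear map $\rho:\tilde L\to\mathrm{End}_k(E)$. Put $R_\rho(u,v)=[\rho(u),\rho(v)]-\rho([u,v])$. $\mathrm{Diff}^l(E)\subseteq\mathrm{End}_k(E)$ is the set of $\partial$ with $[\cdots[\partial,a_1Id_E]\cdots,a_{l+1}Id_E]=0$ for all $a_1,\dots,a_{l+1}\in A$, and $\mathrm{Diff}(E)=\bigcup_{l\ge0}\mathrm{Diff}^l(E)$. $\mathrm{End}(\tilde L,E):=\mathrm{End}_A(E)\oplus\tilde L$ (for $\rho(D)=Id_E$) is the $\mathrm D$-Lie algebra with left action $c(\phi,u)=(c\phi,cu)$, right action $(\phi,u)c=(\phi c,uc)$, bracket $[(\phi,u),(\psi,v)]=([\phi,\psi]+[\rho(u),\psi]-[\rho(v),\phi]+R_\rho(u,v),[u,v])$, central element $\tilde D=(0,D)$, and structure maps $(\phi,u)\mapsto\tilde\alpha(u)\in D^1_f(A)$, $(\phi,u)\mapsto\tilde\pi(u)\in\mathrm{Der}_k(A)$. For a $\mathrm D$-Lie algebra $\tilde M$ with central element $D_{M}$: $U^{\otimes}(\tilde M)=T^*_k(\tilde M)/J_1$, where $T^*_k(\tilde M)$ is the tensor algebra over $k$ and $J_1$ is the 2-sided ideal generated by $D_M-1$, $au-(aD_M)\otimes u$, $vb-v\otimes(bD_M)$ ($a,b\in A$, $u,v\in\tilde M$); $\tilde U^{\otimes}(\tilde M)$ is the quotient of $U^{\otimes}(\tilde M)$ by the 2-sided ideal generated by the elements $u\otimes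 v-v\otimes u-[u,v]$, $u,v\in\tilde M$. It is filtered by the images of $\bigoplus_{j\le i}\tilde M^{\otimes_kj}$, $i\ge0$, and $\tilde U^{\otimes}(\tilde L,\rho)$ carries the image filtration. A ring $U$ with an exhaustive increasing multiplicative filtration $U_0\subseteq U_1\subseteq\cdots$ is almost commutative if $xy-yx\in U_{i+j-1}$ for $x\in U_i,y\in U_j$ (with $U_{-1}=0$). *)

(* Defs.v *)
From HB Require Import structures.
From mathcomp Require Import all_boot all_algebra.
From mathcomp Require Import ring mathcomp_extra boolp classical_sets functions.
Set Implicit Arguments.
Unset Strict Implicit.
Unset Printing Implicit Defensive.
Import GRing.Theory.
Local Open Scope ring_scope.
Local Open Scope classical_set_scope.
Local Open Scope quotient_scope.

(* Rings are pzRingTypes, so that the zero ring is allowed throughout. *)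

Section Ideals.
Variable R : pzRingType.
Implicit Types (I G : set R).

Definition left_ideal I := [/\ I 0,
  forall x y, I x -> I y -> I (x + y) & forall a x, I x -> I (a * x)].

Definition right_ideal I := [/\ I 0,
  forall x y, I x -> I y -> I (x + y) & forall a x, I x -> I (x * a)].

Definition two_sided_ideal I := left_ideal I /\ right_ideal I.

Definition left_noetherian := forall I, left_ideal I ->
  exists n (g : 'I_n -> R), I = [set \sum_j c j * g j | c in [set: 'I_n -> R]].

Definition right_noetherian := forall I, right_ideal I ->
  exists n (g : 'I_n -> R), I = [set \sum_j g j * c j | c in [set: 'I_n -> R]].

Definition noetherian := left_noetherian /\ right_noetherian.

Definition ideal_gen G : set R := smallest two_sided_ideal G.

Lemma ideal_gen_ideal G : two_sided_ideal (ideal_gen G).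
Proof.
split; split.
- by move=> J [[[]]].
- by move=> x y Ix Iy J JG; have [[[_ D _] _] _] := JG; apply: D; [exact: Ix|exact: Iy].
- by move=> a x Ix J JG; have [[[_ _ D] _] _] := JG; apply: D; exact: Ix.
- by move=> J [[[]]].
- by move=> x y Ix Iy J JG; have [[[_ D _] _] _] := JG; apply: D; [exact: Ix|exact: Iy].
- by move=> a x Ix J JG; have [[_ [_ _ D]] _] := JG; apply: D; exact: Ix.
Qed.

End Ideals.

Definition fin_gen (R : pzRingType) (V : lmodType R) :=
  exists n (g : 'I_n -> V), forall v, exists c : 'I_n -> R, v = \sum_j c j *: g j.

Section RingQuotient.
Variables (R : pzRingType) (G : set R).

Definition ideal_pred : R -> bool := fun x => `[< ideal_gen G x >].

Lemma ideal_predP : zmod_closed ideal_pred.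
Proof.
have [[I0 ID IM] _] := ideal_gen_ideal G.
split=> [|x y]; rewrite !unfold_in; first exact/asboolP.
move=> /asboolP Ix /asboolP Iy; apply/asboolP.
by apply: ID => //; rewrite -mulN1r; apply: IM.
Qed.
HB.instance Definition _ := GRing.isZmodClosed.Build R ideal_pred ideal_predP.

Lemma ideal_predMl a x : x \in ideal_pred -> a * x \in ideal_pred.
Proof.
have [[_ _ IM] _] := ideal_gen_ideal G.
by rewrite !unfold_in => /asboolP Ix; apply/asboolP; exact: IM.
Qed.

Lemma ideal_predMr a x : x \in ideal_pred -> x * a \in ideal_pred.
Proof.
have [_ [_ _ IM]] := ideal_gen_ideal G.
by rewrite !unfold_in => /asboolP Ix; apply/asboolP; exact: IM.
Qed.

(* The quotient of R by the two-sided ideal generated by G; the library only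
   equips quotients of commutative rings with a ring structure. *)
Definition quot_ideal : zmodClosed R := GRing.ZmodClosed.clone R ideal_pred _.
Definition quotring := {ideal_quot quot_ideal}.
HB.instance Definition _ := GRing.Zmodule.on quotring.
HB.instance Definition _ := EqQuotient.on quotring.

Definition qproj (x : R) : quotring := \pi_{ideal_quot quot_ideal} x.

Let qone : quotring := qproj 1.
Let qmul (x y : quotring) : quotring := qproj (repr x * repr y).

Lemma qprojP x y : (qproj x == qproj y) = (x - y \in ideal_pred).
Proof. by rewrite Quotient.idealrBE. Qed.

Lemma qreprK (x : quotring) : qproj (repr x) = x.
Proof. exact: reprK. Qed.

Let qmulE x y : qmul (qproj x) (qproj y) = qproj (x * y).
Proof.
apply/eqP; rewrite qprojP.
set x' := repr _; set y' := repr _.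
have -> : x' * y' - x * y = x' * (y' - y) + (x' - x) * y.
  by rewrite mulrBr mulrBl addrA subrK.
apply: rpredD; [apply: ideal_predMl|apply: ideal_predMr];
  by rewrite -qprojP qreprK.
Qed.

Lemma qproj_is_zmod_morphism : zmod_morphism qproj.
Proof. by move=> x y; rewrite /qproj !piE. Qed.
HB.instance Definition _ :=
  GRing.isZmodMorphism.Build R quotring qproj qproj_is_zmod_morphism.

Let qmulA : associative qmul.
Proof.
by move=> x y z; rewrite -[x]qreprK -[y]qreprK -[z]qreprK !qmulE mulrA.
Qed.
Let qmul1r : left_id qone qmul.
Proof. by move=> x; rewrite -[x]qreprK qmulE mul1r. Qed.
Let qmulr1 : right_id qone qmul.
Proof. by move=> x; rewrite -[x]qreprK qmulE mulr1. Qed.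
Let qmulDl : left_distributive qmul +%R.
Proof.
move=> x y z; rewrite -[x]qreprK -[y]qreprK -[z]qreprK.
by rewrite -raddfD !qmulE -raddfD mulrDl.
Qed.
Let qmulDr : right_distributive qmul +%R.
Proof.
move=> x y z; rewrite -[x]qreprK -[y]qreprK -[z]qreprK.
by rewrite -raddfD !qmulE -raddfD mulrDr.
Qed.
HB.instance Definition _ := GRing.Zmodule_isPzRing.Build quotring
  qmulA qmul1r qmulr1 qmulDl qmulDr.

Lemma qproj_is_monoid_morphism : monoid_morphism qproj.
Proof. by split=> // x y; rewrite -qmulE. Qed.
HB.instance Definition _ :=
  GRing.isMonoidMorphism.Build R quotring qproj qproj_is_monoid_morphism.

End RingQuotient.

Section KernelImage.
Variables (R S : pzRingType) (h : {rmorphism R -> S}).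

Definition ker_pred : R -> bool := fun x => h x == 0.

Lemma ker_predP : zmod_closed ker_pred.
Proof.
split=> [|x y]; rewrite !unfold_in ?rmorph0 ?rmorphB //.
by move=> /eqP-> /eqP->; rewrite subrr.
Qed.
HB.instance Definition _ := GRing.isZmodClosed.Build R ker_pred ker_predP.

Record ring_ker := RingKer {ker_val : R; _ : ker_val \in ker_pred}.
HB.instance Definition _ := [isSub for ker_val].
HB.instance Definition _ := [Choice of ring_ker by <:].
HB.instance Definition _ := [SubChoice_isSubZmodule of ring_ker by <:].

Lemma ker_val_is_zmod_morphism : zmod_morphism ker_val.
Proof. by move=> x y; exact: (raddfB (\val : ring_ker -> R)). Qed.
HB.instance Definition _ :=
  GRing.isZmodMorphism.Build ring_ker R ker_val ker_val_is_zmod_morphism.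

Definition im_pred : S -> bool := fun y => `[< range h y >].

Lemma im_predP : subring_closed im_pred.
Proof.
split=> [|x y|x y]; rewrite !unfold_in; first by apply/asboolP; exists 1; rewrite ?rmorph1.
  by move=> /asboolP[a _ <-] /asboolP[b _ <-]; apply/asboolP; exists (a - b); rewrite ?rmorphB.
by move=> /asboolP[a _ <-] /asboolP[b _ <-]; apply/asboolP; exists (a * b); rewrite ?rmorphM.
Qed.
HB.instance Definition _ := GRing.isSubringClosed.Build S im_pred im_predP.

Record ring_im := RingIm {im_val : S; _ : im_val \in im_pred}.
HB.instance Definition _ := [isSub for im_val].
HB.instance Definition _ := [Choice of ring_im by <:].
HB.instance Definition _ := GRing.SubChoice_isSubPzRing.Build S im_pred ring_im im_predP.

Lemma corestr_subproof x : h x \in im_pred.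
Proof. by rewrite unfold_in; apply/asboolP; exists x. Qed.
Definition corestr (x : R) : ring_im := RingIm (corestr_subproof x).

Lemma corestr_is_zmod_morphism : zmod_morphism corestr.
Proof. by move=> x y; apply: val_inj; rewrite /= rmorphB. Qed.
Lemma corestr_is_monoid_morphism : monoid_morphism corestr.
Proof. by split=> [|x y]; apply: val_inj; rewrite /= (rmorph1, rmorphM). Qed.
HB.instance Definition _ :=
  GRing.isZmodMorphism.Build R ring_im corestr corestr_is_zmod_morphism.
HB.instance Definition _ :=
  GRing.isMonoidMorphism.Build R ring_im corestr corestr_is_monoid_morphism.

End KernelImage.

Definition short_exact (U V W : zmodType)
    (f : {additive U -> V}) (g : {additive V -> W}) :=
  [/\ injective f, range f = g @^-1` [set 0] & range g = setT].

Section Filtrations.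
Variable R : pzRingType.
Implicit Type F : nat -> set R.

Definition ring_filtration F :=
  [/\ forall n, F n 0 /\ (forall x y, F n x -> F n y -> F n (x - y)),
      F 0%N 1,
      forall n, F n `<=` F n.+1,
      forall m n x y, F m x -> F n y -> F (m + n)%N (x * y) &
      \bigcup_n F n = setT].

Definition almost_commutative F := ring_filtration F /\
  forall m n x y, F m x -> F n y ->
    if (m + n)%N is p.+1 then F p (x * y - y * x) else x * y - y * x = 0.

End Filtrations.

(* A (x)_k A-modules, for i : k -> A, as A-A-bimodules with symmetric k-action *)
HB.mixin Record Lmodule_isBimodule (k A : comPzRingType)
    (i : {rmorphism k -> A}) M of GRing.Lmodule A M := {
  ract : M -> A -> M;
  ractDl : forall a, {morph ract^~ a : u v / u + v};
  ractDr : forall u, {morph ract u : a b / a + b};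
  ract1 : forall u, ract u 1 = u;
  ractA : forall u a b, ract (ract u a) b = ract u (a * b);
  ractZ : forall a u b, ract (a *: u) b = a *: ract u b;
  ract_base : forall c u, ract u (i c) = i c *: u
}.
#[short(type="bimodType")]
HB.structure Definition Bimodule (k A : comPzRingType) (i : {rmorphism k -> A})
  := {M of GRing.Lmodule A M & Lmodule_isBimodule k A i M}.

(* A (x)_k A-modules with a k-Lie algebra structure *)
HB.mixin Record Bimodule_isLie (k A : comPzRingType)
    (i : {rmorphism k -> A}) M of @Bimodule k A i M := {
  lie : M -> M -> M;
  lieDl : forall w, {morph lie^~ w : u v / u + v};
  lieDr : forall w, {morph lie w : u v / u + v};
  lieZl : forall c u v, lie (i c *: u) v = i c *: lie u v;
  lieZr : forall c u v, lie u (i c *: v) = i c *: lie u v;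
  lie_alt : forall u, lie u u = 0;
  lie_jacobi : forall u v w,
    lie u (lie v w) + lie v (lie w u) + lie w (lie u v) = 0
}.
#[short(type="lieBimodType")]
HB.structure Definition LieBimodule (k A : comPzRingType)
  (i : {rmorphism k -> A}) := {M of @Bimodule k A i M & Bimodule_isLie k A i M}.

Definition bimod_hom (k A : comPzRingType) (i : {rmorphism k -> A})
    (M N : bimodType i) (h : M -> N) :=
  linear h /\ forall u a, h (ract u a) = ract (h u) a.

Definition lie_hom (k A : comPzRingType) (i : {rmorphism k -> A})
    (M N : lieBimodType i) (h : M -> N) := {morph h : u v / lie u v}.

Section Derivations.
Variables (k A : comPzRingType) (i : {rmorphism k -> A}).

Definition is_der (x : A -> A) :=
  [/\ {morph x : a b / a + b}, forall c a, x (i c * a) = i c * x a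
    & forall a b, x (a * b) = x a * b + a * x b].

Definition der_pred : (A -> A^o) -> bool := fun x => `[< is_der x >].

Lemma der_predP : submod_closed der_pred.
Proof.
split=> [|a x y]; rewrite !unfold_in.
  apply/asboolP; split=> [a b|c a|a b]; rewrite /= ?addr0 ?mulr0 //.
  by rewrite mul0r addr0.
move=> /asboolP[xD xk xM] /asboolP[yD yk yM]; apply/asboolP.
have E c : (a *: x + y) c = a * x c + y c by [].
split=> [b c|c b|b c]; rewrite !E.
- by rewrite xD yD mulrDr addrACA.
- by rewrite xk yk mulrDr mulrCA.
- by rewrite xM yM !mulrDr mulrDl !mulrA (mulrC a b) addrACA.
Qed.
HB.instance Definition _ := GRing.isSubmodClosed.Build A (A -> A^o) der_pred der_predP.

Record der := Der {der_fun :> A -> A^o; _ : der_fun \in der_pred}.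
HB.instance Definition _ := [isSub for der_fun].
HB.instance Definition _ := [Choice of der by <:].
HB.instance Definition _ := [SubChoice_isSubLmodule of der by <:].

Implicit Types x y z : der.

Lemma derP x : is_der x.
Proof. by have := valP x; rewrite unfold_in => /asboolP. Qed.

Lemma derD x : {morph x : a b / a + b}. Proof. by case: (derP x). Qed.
Lemma der_base x c a : x (i c * a) = i c * x a. Proof. by case: (derP x). Qed.
Lemma derM x a b : x (a * b) = x a * b + a * x b. Proof. by case: (derP x). Qed.
Lemma der0 x : x 0 = 0.
Proof. by apply: (addrI (x 0)); rewrite -derD !addr0. Qed.
Lemma derN x a : x (- a) = - x a.
Proof. by apply: (addrI (x a)); rewrite -derD !subrr der0. Qed.
Lemma derB x a b : x (a - b) = x a - x b. Proof. by rewrite derD derN. Qed.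
Lemma der1 x : x 1 = 0.
Proof. by apply: (addrI (x 1)); rewrite addr0 -[RHS](congr1 x (mulr1 1)) derM mulr1 mul1r. Qed.
Lemma der_i x c : x (i c) = 0.
Proof. by rewrite -[i c]mulr1 der_base der1 mulr0. Qed.

Lemma der_ext x y : (forall a, x a = y a) -> x = y.
Proof. by move=> h; apply/val_inj/funext. Qed.

Lemma der_addE x y a : (x + y) a = x a + y a. Proof. by []. Qed.
Lemma der_oppE x a : (- x) a = - x a. Proof. by []. Qed.
Lemma der_scaleE b x a : (b *: x) a = b * x a. Proof. by []. Qed.

Let der_ract x a : der := a *: x.

HB.instance Definition _ := Lmodule_isBimodule.Build k A i der
  (fun a => scalerDr a) (fun u => fun a b => scalerDl u a b) (@scale1r _ _)
  (fun u a b => etrans (scalerA b a u) (congr1 (fun c => c *: u) (mulrC b a)))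
  (fun a u b => etrans (scalerA b a u) (etrans (congr1 (fun c => c *: u) (mulrC b a)) (esym (scalerA a b u))))
  (fun c u => erefl (i c *: u) : der_ract u (i c) = _).

Lemma der_lie_subproof x y :
  ((fun a => x (y a) - y (x a)) : A -> A^o) \in der_pred.
Proof.
rewrite unfold_in; apply/asboolP; split=> [a b|c a|a b].
- by rewrite !derD opprD addrACA.
- by rewrite !der_base mulrBr.
- rewrite !derM !derD !derM mulrBl mulrBr.
  rewrite !opprD !addrA; ring.
Qed.
Definition der_lie x y : der := Der (der_lie_subproof x y).


Let lieE x y a : der_lie x y a = x (y a) - y (x a). Proof. by []. Qed.
Let lieDl z : {morph der_lie^~ z : x y / x + y}.
Proof.
by move=> x y; apply: der_ext => a; rewrite der_addE !lieE !der_addE derD opprD addrACA.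
Qed.
Let lie_anti x y : der_lie x y = - der_lie y x.
Proof. by apply: der_ext => a; rewrite der_oppE !lieE opprB. Qed.
Let lieDr z : {morph der_lie z : x y / x + y}.
Proof. by move=> x y; rewrite lie_anti lieDl opprD -!(lie_anti z). Qed.
Let lieZl c x y : der_lie (i c *: x) y = i c *: der_lie x y.
Proof.
by apply: der_ext => a; rewrite der_scaleE !lieE !der_scaleE der_base -mulrBr.
Qed.
Let lieZr c x y : der_lie x (i c *: y) = i c *: der_lie x y.
Proof. by rewrite lie_anti lieZl -scalerN -lie_anti. Qed.
Let lie_alt x : der_lie x x = 0.
Proof. by apply: der_ext => a; rewrite lieE subrr. Qed.
Let lie_jacobi x y z : der_lie x (der_lie y z) + der_lie y (der_lie z x) +
  der_lie z (der_lie x y) = 0.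
Proof.
apply: der_ext => a; rewrite 2!der_addE !lieE !derB.
by have -> : (0 : der) a = 0 by []; ring.
Qed.
HB.instance Definition _ := Bimodule_isLie.Build k A i der
  lieDl lieDr lieZl lieZr lie_alt lie_jacobi.

Lemma der_lieE x y a : lie x y a = x (y a) - y (x a). Proof. by []. Qed.

End Derivations.

Record cocycle2 (k A : comPzRingType) (i : {rmorphism k -> A}) := Cocycle2 {
  cocycle_fun :> der i -> der i -> A;
  cocycle_linl : forall y : der i, linear (cocycle_fun^~ y : der i -> A^o);
  cocycle_linr : forall x : der i, linear (cocycle_fun x : der i -> A^o);
  cocycle_alt : forall x, cocycle_fun x x = 0;
  cocycleP : forall x y z : der i,
    x (cocycle_fun y z) - y (cocycle_fun x z) + z (cocycle_fun x y)
    - cocycle_fun (lie x y) z + cocycle_fun (lie x z) y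
    - cocycle_fun (lie y z) x = 0
}.

Section D1.
Variables (k A : comPzRingType) (i : {rmorphism k -> A}) (f : cocycle2 i).
Implicit Types x y z : der i.

Lemma cocycleDl x y z : f (x + y) z = f x z + f y z.
Proof. by have := cocycle_linl f z 1 x y; rewrite !scale1r. Qed.
Lemma cocycleDr x y z : f z (x + y) = f z x + f z y.
Proof. by have := cocycle_linr f z 1 x y; rewrite !scale1r. Qed.
Lemma cocycle_anti x y : f x y = - f y x.
Proof.
have := cocycle_alt f (x + y); rewrite cocycleDl !cocycleDr !cocycle_alt.
by rewrite add0r addr0 => /eqP; rewrite addr_eq0 => /eqP.
Qed.
Lemma cocycle0l y : f 0 y = 0.
Proof. by apply: (addrI (f 0 y)); rewrite -cocycleDl !addr0. Qed.
Lemma cocycleZl a x y : f (a *: x) y = a * f x y.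
Proof. by have := cocycle_linl f y a x 0; rewrite cocycle0l !addr0. Qed.
Lemma cocycleNl x y : f (- x) y = - f x y.
Proof. by rewrite -scaleN1r cocycleZl mulN1r. Qed.

(* (a, x) stands for aI + x; f only enters the bracket, D1_lie. *)
Definition D1 of cocycle2 i : Type := (A^o * der i)%type.
HB.instance Definition _ := GRing.Lmodule.on (D1 f).

Implicit Types u v w : D1 f.

Definition D1_ract u (c : A) : D1 f := (u.1 * c + u.2 c, c *: u.2).

Lemma D1_ext u v : u.1 = v.1 -> u.2 = v.2 -> u = v.
Proof. by case: u v => [a x] [b y] /= -> ->. Qed.

Definition D1_lie u v : D1 f :=
  (u.2 v.1 - v.2 u.1 + f u.2 v.2, lie u.2 v.2).

Let D1E := ((fun u v => erefl : (u + v).1 = (u.1 : A) + v.1 :> A),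
  (fun u v => erefl : (u + v).2 = u.2 + v.2),
  (fun u => erefl : (- u).1 = - (u.1 : A) :> A),
  (fun u => erefl : (- u).2 = - u.2),
  (fun a u => erefl : (a *: u).1 = a * u.1 :> A),
  (fun a u => erefl : (a *: u).2 = a *: u.2),
  (fun u c => erefl : (D1_ract u c).1 = u.1 * c + u.2 c :> A),
  (fun u c => erefl : (D1_ract u c).2 = c *: u.2),
  (fun u v => erefl : (D1_lie u v).1 = u.2 v.1 - v.2 u.1 + f u.2 v.2 :> A),
  (fun u v => erefl : (D1_lie u v).2 = lie u.2 v.2)).

Let ractDl c : {morph D1_ract^~ c : u v / u + v}.
Proof.
by move=> u v; apply: D1_ext; rewrite !D1E ?scalerDr // der_addE; ring.
Qed.
Let ractDr u : {morph D1_ract u : a b / a + b}.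
Proof.
by move=> a b; apply: D1_ext; rewrite !D1E ?scalerDl // derD; ring.
Qed.
Let ract1 u : D1_ract u 1 = u.
Proof. by apply: D1_ext; rewrite !D1E ?scale1r // der1; ring. Qed.
Let ractA u a b : D1_ract (D1_ract u a) b = D1_ract u (a * b).
Proof.
apply: D1_ext; rewrite !D1E; last by rewrite scalerA mulrC.
by rewrite derM der_scaleE; ring.
Qed.
Let ractZ a u b : D1_ract (a *: u) b = a *: D1_ract u b.
Proof.
apply: D1_ext; rewrite !D1E; last by rewrite !scalerA mulrC.
by rewrite der_scaleE; ring.
Qed.
Let ract_base c u : D1_ract u (i c) = i c *: u.
Proof. by apply: D1_ext; rewrite !D1E // der_i; ring. Qed.
HB.instance Definition _ := Lmodule_isBimodule.Build k A i (D1 f)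
  ractDl ractDr ract1 ractA ractZ ract_base.

Let D1lieDl w : {morph D1_lie^~ w : u v / u + v}.
Proof.
move=> u v; apply: D1_ext; rewrite !D1E ?lieDl //.
by rewrite der_addE derD cocycleDl; ring.
Qed.
Let D1lie_anti u v : D1_lie u v = - D1_lie v u.
Proof.
apply: D1_ext; rewrite !D1E; first by rewrite cocycle_anti; ring.
by apply: der_ext => c; rewrite der_oppE !der_lieE; ring.
Qed.
Let D1lieDr w : {morph D1_lie w : u v / u + v}.
Proof. by move=> u v; rewrite D1lie_anti D1lieDl opprD -!(D1lie_anti w). Qed.
Let D1lieZl c u v : D1_lie (i c *: u) v = i c *: D1_lie u v.
Proof.
apply: D1_ext; rewrite !D1E ?lieZl //.
by rewrite der_scaleE cocycleZl der_base; ring.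
Qed.
Let D1lieZr c u v : D1_lie u (i c *: v) = i c *: D1_lie u v.
Proof. by rewrite D1lie_anti D1lieZl -scalerN -D1lie_anti. Qed.
Let D1lie_alt u : D1_lie u u = 0.
Proof.
by apply: D1_ext; rewrite !D1E ?lie_alt // subrr cocycle_alt addr0.
Qed.
Let D1lie_jacobi u v w :
  D1_lie u (D1_lie v w) + D1_lie v (D1_lie w u) + D1_lie w (D1_lie u v) = 0.
Proof.
apply: D1_ext; rewrite !D1E; last by rewrite lie_jacobi.
move: u.1 u.2 v.1 v.2 w.1 w.2 => a x b y c z.
rewrite !der_lieE !(derD, derN).
have := cocycleP f x y z.
rewrite (cocycle_anti x (lie y z)) (cocycle_anti y (lie z x)).
rewrite (cocycle_anti z (lie x y)) (cocycle_anti z x).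
have -> : lie z x = - lie x z.
  by apply: der_ext => d; rewrite der_oppE !der_lieE; ring.
by rewrite cocycleNl derN => /(etrans _); apply; ring.
Qed.
HB.instance Definition _ := Bimodule_isLie.Build k A i (D1 f)
  D1lieDl D1lieDr D1lieZl D1lieZr D1lie_alt D1lie_jacobi.

Definition D1_proj (u : D1 f) : der i := u.2.

End D1.

Record dlie (k A : comPzRingType) (i : {rmorphism k -> A}) (f : cocycle2 i) :=
  DLie {
  dlie_car :> lieBimodType i;
  dlie_alpha : dlie_car -> D1 f;
  dlie_pi : dlie_car -> der i;
  dlie_D : dlie_car;
  dlie_alpha_bimod : bimod_hom dlie_alpha;
  dlie_alpha_lie : lie_hom dlie_alpha;
  dlie_pi_bimod : bimod_hom dlie_pi;
  dlie_pi_lie : lie_hom dlie_pi;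
  dlie_alpha_pi : forall u, D1_proj (dlie_alpha u) = dlie_pi u;
  dlie_D_central : forall u, lie u dlie_D = 0;
  dlie_pi_D : dlie_pi dlie_D = 0;
  dlie_ract : forall u c, ract u c = c *: u + (dlie_pi u c : A) *: dlie_D;
  dlie_leibniz : forall u v c,
    lie u (c *: v) = c *: lie u v + (dlie_pi u c : A) *: v
}.

Section Endomorphisms.
Variables (k A : comPzRingType) (i : {rmorphism k -> A}) (E : lmodType A).

Definition endk_pred : (E -> E) -> bool := fun p =>
  `[< {morph p : e e' / e + e'} /\ forall c e, p (i c *: e) = i c *: p e >].

Lemma endk_predP : submod_closed endk_pred.
Proof.
split=> [|a p q]; rewrite !unfold_in.
  by apply/asboolP; split=> [e e'|c e]; rewrite /= ?addr0 ?scaler0.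
move=> /asboolP[pD pk] /asboolP[qD qk]; apply/asboolP.
have H e : (a *: p + q) e = a *: p e + q e by [].
split=> [e e'|c e]; rewrite !H.
- by rewrite pD qD scalerDr addrACA.
- by rewrite pk qk scalerDr !scalerA mulrC.
Qed.
HB.instance Definition _ := GRing.isSubmodClosed.Build A (E -> E) endk_pred endk_predP.

Record endk := Endk {endk_fun :> E -> E; _ : endk_fun \in endk_pred}.
HB.instance Definition _ := [isSub for endk_fun].
HB.instance Definition _ := [Choice of endk by <:].
HB.instance Definition _ := [SubChoice_isSubLmodule of endk by <:].

Implicit Types p q r : endk.

Lemma endkP p : {morph p : e e' / e + e'} /\ forall c e, p (i c *: e) = i c *: p e.
Proof. by have := valP p; rewrite unfold_in => /asboolP. Qed.
Lemma endkD p : {morph p : e e' / e + e'}. Proof. by case: (endkP p). Qed.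
Lemma endk_base p c e : p (i c *: e) = i c *: p e. Proof. by case: (endkP p). Qed.
Lemma endk_ext p q : (forall e, p e = q e) -> p = q.
Proof. by move=> h; apply/val_inj/funext. Qed.
Lemma endk_addE p q e : (p + q) e = p e + q e. Proof. by []. Qed.
Lemma endk_oppE p e : (- p) e = - p e. Proof. by []. Qed.
Lemma endk_scaleE a p e : (a *: p) e = a *: p e. Proof. by []. Qed.

Let endk_one_subproof : idfun \in endk_pred.
Proof. by rewrite unfold_in; apply/asboolP. Qed.
Let endk_one : endk := Endk endk_one_subproof.
Let endk_mul_subproof p q : p \o q \in endk_pred.
Proof.
by rewrite unfold_in; apply/asboolP; split=> [e e'|c e] /=;
  rewrite ?endkD ?endk_base.
Qed.
Let endk_mul p q : endk := Endk (endk_mul_subproof p q).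
Let mulE p q e : endk_mul p q e = p (q e). Proof. by []. Qed.
Let mulA : associative endk_mul. Proof. by move=> p q r; exact: endk_ext. Qed.
Let mul1 : left_id endk_one endk_mul. Proof. by move=> p; exact: endk_ext. Qed.
Let mulr1' : right_id endk_one endk_mul. Proof. by move=> p; exact: endk_ext. Qed.
Let mulDl : left_distributive endk_mul +%R.
Proof. by move=> p q r; exact: endk_ext. Qed.
Let mulDr : right_distributive endk_mul +%R.
Proof.
by move=> p q r; apply: endk_ext => e; rewrite endk_addE !mulE endk_addE endkD.
Qed.
HB.instance Definition _ :=
  GRing.Zmodule_isPzRing.Build endk mulA mul1 mulr1' mulDl mulDr.

Lemma endk_mulE p q e : (p * q) e = p (q e). Proof. by []. Qed.
Lemma endk_oneE e : (1 : endk) e = e. Proof. by []. Qed.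
Lemma endk_scaleAl a p q : a *: (p * q) = (a *: p) * q.
Proof. exact: endk_ext. Qed.
Lemma endk_base_scaleAr c p q : i c *: (p * q) = p * (i c *: q).
Proof.
by apply: endk_ext => e; rewrite endk_mulE !endk_scaleE endk_base.
Qed.

Definition scal_id (a : A) : endk := a *: (1 : endk).

Definition endk_ract p a : endk := p * scal_id a.

Lemma endk_ractE p a e : endk_ract p a e = p (a *: e). Proof. by []. Qed.

Let ractDl a : {morph endk_ract^~ a : p q / p + q}.
Proof. by move=> p q; rewrite /endk_ract mulrDl. Qed.
Let ractDr p : {morph endk_ract p : a b / a + b}.
Proof. by move=> a b; rewrite /endk_ract /scal_id scalerDl mulrDr. Qed.
Let ract1 p : endk_ract p 1 = p.
Proof. by rewrite /endk_ract /scal_id scale1r mulr1. Qed.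
Let ractA p a b : endk_ract (endk_ract p a) b = endk_ract p (a * b).
Proof. by apply: endk_ext => e; rewrite !endk_ractE scalerA. Qed.
Let ractZ a p b : endk_ract (a *: p) b = a *: endk_ract p b.
Proof. by apply: endk_ext. Qed.
Let ract_base c p : endk_ract p (i c) = i c *: p.
Proof.
by apply: endk_ext => e; rewrite endk_ractE endk_scaleE endk_base.
Qed.
HB.instance Definition _ := Lmodule_isBimodule.Build k A i endk
  ractDl ractDr ract1 ractA ractZ ract_base.

Definition endk_lie p q : endk := p * q - q * p.
Let lieDl' r : {morph endk_lie^~ r : p q / p + q}.
Proof.
by move=> p q; rewrite /endk_lie mulrDl mulrDr opprD addrACA.
Qed.
Let lieDr' r : {morph endk_lie r : p q / p + q}.
Proof.
by move=> p q; rewrite /endk_lie mulrDl mulrDr opprD addrACA.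
Qed.
Let lieZl' c p q : endk_lie (i c *: p) q = i c *: endk_lie p q.
Proof.
by rewrite /endk_lie -endk_scaleAl -endk_base_scaleAr -scalerBr.
Qed.
Let lieZr' c p q : endk_lie p (i c *: q) = i c *: endk_lie p q.
Proof.
by rewrite /endk_lie -endk_scaleAl -endk_base_scaleAr -scalerBr.
Qed.
Let lie_alt' p : endk_lie p p = 0. Proof. exact: subrr. Qed.
Let lie_jacobi' p q r :
  endk_lie p (endk_lie q r) + endk_lie q (endk_lie r p)
  + endk_lie r (endk_lie p q) = 0.
Proof.
rewrite /endk_lie !mulrBr !mulrBl !mulrA !opprB.
set a := p * q * r; set b := p * r * q; set c := q * r * p.
set d := r * q * p; set e := q * p * r; set g := r * p * q.
have t (x y z : endk) : x - y + (y - z) = x - z by rewrite addrA subrK.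
by rewrite (addrC (c - e)) (addrACA (a - b)) !t addrACA !t subrr.
Qed.
HB.instance Definition _ := Bimodule_isLie.Build k A i endk
  lieDl' lieDr' lieZl' lieZr' lie_alt' lie_jacobi'.

Lemma endk_lieE p q : lie p q = p * q - q * p. Proof. by []. Qed.

Definition enda_pred : endk -> bool :=
  fun p => `[< forall a e, p (a *: e) = a *: p e >].

Lemma enda_predP : submod_closed enda_pred.
Proof.
split=> [|a p q]; rewrite !unfold_in.
  by apply/asboolP=> a e; rewrite scaler0.
move=> /asboolP pA /asboolP qA; apply/asboolP => b e.
by rewrite !endk_addE !endk_scaleE pA qA scalerDr !scalerA mulrC.
Qed.
HB.instance Definition _ := GRing.isSubmodClosed.Build A endk enda_pred enda_predP.

Record enda := Enda {enda_val :> endk; _ : enda_val \in enda_pred}.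
HB.instance Definition _ := [isSub for enda_val].
HB.instance Definition _ := [Choice of enda by <:].
HB.instance Definition _ := [SubChoice_isSubLmodule of enda by <:].

Lemma endaP (p : enda) a e : p (a *: e) = a *: p e.
Proof. by have := valP p; rewrite unfold_in => /asboolP; apply. Qed.

Definition diff_op (l : nat) (d : endk) : Prop :=
  forall s : l.+1.-tuple A, foldl (fun d a => lie d (scal_id a)) d s = 0.

Local Notation com d a := (lie d (scal_id a)).

Lemma scal_idE a e : scal_id a e = a *: e. Proof. by []. Qed.
Lemma scal_idM a d : scal_id a * d = a *: d. Proof. exact: endk_ext. Qed.
Lemma scal_idD a b : scal_id (a + b) = scal_id a + scal_id b.
Proof. exact: scalerDl. Qed.
Lemma scal_idN a : scal_id (- a) = - scal_id a.
Proof. by apply: endk_ext => e; rewrite endk_oppE !scal_idE scaleNr. Qed.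
Lemma scal_idC a b : scal_id a * scal_id b = scal_id b * scal_id a.
Proof.
by apply: endk_ext => e; rewrite !endk_mulE !scal_idE !scalerA mulrC.
Qed.
Lemma com_scal a b : com (scal_id b) a = 0.
Proof. by rewrite endk_lieE scal_idC subrr. Qed.
Lemma endk_antiC p q : lie p q = - lie q p.
Proof. by rewrite !endk_lieE opprB. Qed.
Lemma endk_lie0l p : lie 0 p = 0 :> endk.
Proof. by rewrite endk_lieE mul0r mulr0 subrr. Qed.
Lemma endk_lie0r p : lie p 0 = 0 :> endk.
Proof. by rewrite endk_lieE mul0r mulr0 subrr. Qed.
Lemma endk_lieNl p q : lie (- p) q = - lie p q.
Proof. by rewrite !endk_lieE mulNr mulrN opprB opprK addrC. Qed.
Lemma endk_lieNr p q : lie p (- q) = - lie p q.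
Proof. by rewrite !endk_lieE mulNr mulrN opprB opprK addrC. Qed.
Lemma endk_lieM p q r : lie (p * q) r = p * lie q r + lie p r * q.
Proof. by rewrite !endk_lieE mulrBr mulrBl !mulrA addrA subrK. Qed.
Lemma endk_lie_lie p q r : lie (lie p q) r = lie (lie p r) q + lie p (lie q r).
Proof.
rewrite (endk_lieE p q) (endk_lieE (lie p r)) (endk_lieE p (lie q r)).
by rewrite lieDl endk_lieNl !endk_lieM opprD (addrC (p * _)) addrACA.
Qed.
Lemma comZ b d a : com (b *: d) a = b *: com d a.
Proof. by rewrite -scal_idM endk_lieM com_scal mul0r addr0 scal_idM. Qed.

Lemma enda_com p : p \in enda_pred <-> forall a, com p a = 0.
Proof.
rewrite unfold_in; split=> [/asboolP pA a|pA].
  by apply: endk_ext => e; rewrite endk_lieE endk_addE endk_oppE !endk_mulE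
    !scal_idE pA subrr.
apply/asboolP => a e; have /eqP := congr1 (fun d : endk => d e) (pA a).
by rewrite endk_lieE endk_addE endk_oppE !endk_mulE !scal_idE subr_eq0 => /eqP.
Qed.

Lemma enda_ract_subproof (p : enda) a : ract (p : endk) a \in enda_pred.
Proof.
rewrite unfold_in; apply/asboolP => b e.
by rewrite !endk_ractE scalerA mulrC -scalerA endaP.
Qed.
Definition enda_ract (p : enda) a : enda := Enda (enda_ract_subproof p a).

Let ractDl' a : {morph enda_ract^~ a : u v / u + v}.
Proof. by move=> p q; apply/val_inj/ractDl. Qed.
Let ractDr' (p : enda) : {morph enda_ract p : a b / a + b}.
Proof. by move=> a b; apply/val_inj/ractDr. Qed.
Let ract1' (p : enda) : enda_ract p 1 = p.
Proof. by apply/val_inj/ract1. Qed.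
Let ractA' (p : enda) a b : enda_ract (enda_ract p a) b = enda_ract p (a * b).
Proof. by apply/val_inj/ractA. Qed.
Let ractZ' a (p : enda) b : enda_ract (a *: p) b = a *: enda_ract p b.
Proof. by apply/val_inj/ractZ. Qed.
Let ract_base' c (p : enda) : enda_ract p (i c) = i c *: p.
Proof. by apply/val_inj/ract_base. Qed.
HB.instance Definition _ := Lmodule_isBimodule.Build k A i enda
  ractDl' ractDr' ract1' ractA' ractZ' ract_base'.

Definition diff1_pred : endk -> bool := fun d => `[< diff_op 1 d >].

Lemma diff_op0P d : diff_op 0 d <-> forall a, com d a = 0.
Proof.
split=> [h a|h s]; first exact: (h [tuple a]).
by case/tupleP: s => a s; rewrite (tuple0 s) /= h.
Qed.
Lemma diff_opSP l d : diff_op l.+1 d <-> forall a, diff_op l (com d a).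
Proof.
split=> [h a s|h s]; first exact: (h [tuple of a :: s]).
by case/tupleP: s => a s; exact: (h a s).
Qed.
Lemma diff_op1P d : diff_op 1 d <-> forall a b, com (com d a) b = 0.
Proof.
split=> [/diff_opSP h a b|h].
  by have /diff_op0P := h a; apply.
by apply/diff_opSP => a; apply/diff_op0P.
Qed.

Lemma diff_opB l c d : diff_op l c -> diff_op l d -> diff_op l (c - d).
Proof.
elim: l c d => [|l IH] c d.
  move=> /diff_op0P hc /diff_op0P hd; apply/diff_op0P => a.
  by rewrite lieDl endk_lieNl hc hd subrr.
move=> /diff_opSP hc /diff_opSP hd; apply/diff_opSP => a.
by rewrite lieDl endk_lieNl; apply: IH.
Qed.
Lemma diff_opS l d : diff_op l d -> diff_op l.+1 d.
Proof.
elim: l d => [|l IH] d.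
  by move=> /diff_op0P h; apply/diff_op1P => a b; rewrite h endk_lie0l.
by move=> /diff_opSP h; apply/diff_opSP => a; apply: IH.
Qed.
Lemma diff_opW m n d : (m <= n)%N -> diff_op m d -> diff_op n d.
Proof.
by move=> /subnK <-; elim: (n - m)%N => // l IH h; apply/diff_opS/IH.
Qed.
Lemma diff_op_0 l : diff_op l 0.
Proof.
by apply: (@diff_opW 0) => //; apply/diff_op0P => a; rewrite endk_lie0l.
Qed.
Lemma diff_opD l c d : diff_op l c -> diff_op l d -> diff_op l (c + d).
Proof.
move=> hc hd; rewrite -[d]opprK; apply: diff_opB => //.
by rewrite -sub0r; apply: diff_opB => //; apply: diff_op_0.
Qed.
Lemma diff_opM m n p q : diff_op m p -> diff_op n q -> diff_op (m + n) (p * q).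
Proof.
elim: m n p q => [|m IHm].
  elim=> [|n IHn] p q /diff_op0P hp.
    move=> /diff_op0P hq; apply/diff_op0P => a.
    by rewrite endk_lieM hp hq mul0r mulr0 addr0.
  move=> /diff_opSP hq; apply/diff_opSP => a.
  rewrite endk_lieM hp mul0r addr0; apply: IHn => //; exact/diff_op0P.
elim=> [|n IHn] p q hp hq; rewrite addSn; apply/diff_opSP => a;
  rewrite endk_lieM.
  have/diff_op0P -> := hq; rewrite mulr0 add0r.
  by apply: IHm => //; move/diff_opSP: hp; apply.
apply: diff_opD; last by apply: IHm => //; move/diff_opSP: hp; apply.
by rewrite addnS -addSn; apply: IHn => //; move/diff_opSP: hq; apply.
Qed.

Lemma diff1_predP : submod_closed diff1_pred.
Proof.
split=> [|a p q]; rewrite !unfold_in; first exact/asboolP/diff_op_0.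
move=> /asboolP/diff_op1P hp /asboolP hq; apply/asboolP/diff_opD => //.
by apply/diff_op1P => b c; rewrite !comZ hp scaler0.
Qed.
HB.instance Definition _ := GRing.isSubmodClosed.Build A endk diff1_pred diff1_predP.

(* Diff^1(E); it is in general not closed under commutators *)
Record diff1 := Diff1 {diff1_val :> endk; _ : diff1_val \in diff1_pred}.
HB.instance Definition _ := [isSub for diff1_val].
HB.instance Definition _ := [Choice of diff1 by <:].
HB.instance Definition _ := [SubChoice_isSubLmodule of diff1 by <:].

Lemma diff1_ract_subproof (d : diff1) a : ract (d : endk) a \in diff1_pred.
Proof.
have := valP d; rewrite !unfold_in => /asboolP/diff_op1P h.
apply/asboolP/diff_op1P => b c.
have H p b' : com (p * scal_id a) b' = com p b' * scal_id a.
  by rewrite endk_lieM com_scal mulr0 add0r.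
by rewrite !H h mul0r.
Qed.
Definition diff1_ract (d : diff1) a : diff1 := Diff1 (diff1_ract_subproof d a).

Let ractDl'' a : {morph diff1_ract^~ a : u v / u + v}.
Proof. by move=> p q; apply/val_inj/ractDl. Qed.
Let ractDr'' (p : diff1) : {morph diff1_ract p : a b / a + b}.
Proof. by move=> a b; apply/val_inj/ractDr. Qed.
Let ract1'' (p : diff1) : diff1_ract p 1 = p.
Proof. by apply/val_inj/ract1. Qed.
Let ractA'' (p : diff1) a b : diff1_ract (diff1_ract p a) b = diff1_ract p (a * b).
Proof. by apply/val_inj/ractA. Qed.
Let ractZ'' a (p : diff1) b : diff1_ract (a *: p) b = a *: diff1_ract p b.
Proof. by apply/val_inj/ractZ. Qed.
Let ract_base'' c (p : diff1) : diff1_ract p (i c) = i c *: p.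
Proof. by apply/val_inj/ract_base. Qed.
HB.instance Definition _ := Lmodule_isBimodule.Build k A i diff1
  ractDl'' ractDr'' ract1'' ractA'' ractZ'' ract_base''.

Definition diff_pred : endk -> bool := fun d => `[< exists l, diff_op l d >].

Lemma diff_predP : subring_closed diff_pred.
Proof.
split=> [|p q|p q]; rewrite !unfold_in.
- apply/asboolP; exists 0%N; apply/diff_op0P => a.
  by rewrite endk_lieE mul1r mulr1 subrr.
- move=> /asboolP[m hm] /asboolP[n hn]; apply/asboolP; exists (maxn m n).
  by apply: diff_opB; [apply: diff_opW hm|apply: diff_opW hn];
    rewrite (leq_maxl, leq_maxr).
- move=> /asboolP[m hm] /asboolP[n hn]; apply/asboolP; exists (m + n)%N.
  exact: diff_opM.
Qed.
HB.instance Definition _ := GRing.isSubringClosed.Build endk diff_pred diff_predP.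

Record diff := Diff {diff_val :> endk; _ : diff_val \in diff_pred}.
HB.instance Definition _ := [isSub for diff_val].
HB.instance Definition _ := [Choice of diff by <:].
HB.instance Definition _ :=
  GRing.SubChoice_isSubPzRing.Build endk diff_pred diff diff_predP.

End Endomorphisms.

Record connection (k A : comPzRingType) (i : {rmorphism k -> A})
    (f : cocycle2 i) (L : dlie f) (E : lmodType A) := Connection {
  conn_fun :> L -> endk i E;
  conn_hom : bimod_hom conn_fun
}.

Section EndL.
Variables (k A : comPzRingType) (i : {rmorphism k -> A}) (f : cocycle2 i).
Variables (L : dlie f) (E : lmodType A) (rho : connection L E).
Hypothesis rhoD : rho (dlie_D L) = 1.
Implicit Types (p q : enda i E) (u v w : L).

Local Notation com d a := (lie d (scal_id i E a)).

Definition curvature u v : endk i E := lie (rho u) (rho v) - rho (lie u v).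

Lemma connD u v : rho (u + v) = rho u + rho v.
Proof. by have := (conn_hom rho).1 1 u v; rewrite !scale1r. Qed.
Lemma conn0 : rho 0 = 0.
Proof. by apply: (addrI (rho 0)); rewrite -connD !addr0. Qed.
Lemma connZ a u : rho (a *: u) = a *: rho u.
Proof. by have := (conn_hom rho).1 a u 0; rewrite conn0 !addr0. Qed.
Lemma connN u : rho (- u) = - rho u.
Proof. by rewrite -scaleN1r connZ scaleN1r. Qed.

Lemma com_conn u a : com (rho u) a = scal_id i E (dlie_pi u a).
Proof.
have H := (conn_hom rho).2 u a.
rewrite endk_lieE -[rho u * _]/(ract (rho u) a) -H dlie_ract.
by rewrite connD !connZ rhoD scal_idM addrAC subrr add0r.
Qed.

Lemma com_enda p a : com (p : endk i E) a = 0.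
Proof. by have /enda_com := valP p; apply. Qed.

Lemma lie_scal_enda p a : lie (scal_id i E a) p = 0.
Proof. by rewrite endk_antiC com_enda oppr0. Qed.

Lemma EndL_lie_subproof p q u v :
  lie (p : endk i E) q + lie (rho u) q - lie (rho v) p + curvature u v
  \in enda_pred (i:=i) (E:=E).
Proof.
have enda_lie w r : lie (rho w) (r : enda i E) \in enda_pred (i:=i) (E:=E).
  apply/enda_com => a; rewrite endk_lie_lie com_conn com_enda.
  by rewrite lie_scal_enda endk_lie0r addr0.
apply: rpredD; last first.
  apply/enda_com => a; rewrite /curvature.
  rewrite (lieDl _ (lie (rho u) (rho v)) (- rho (lie u v))).
  rewrite endk_lieNl endk_lie_lie !com_conn (endk_antiC (scal_id i E _)) com_conn.
  have -> : dlie_pi (lie u v) = lie (dlie_pi u) (dlie_pi v) by apply: dlie_pi_lie.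
  rewrite der_lieE scal_idD scal_idN opprD opprK.
  by rewrite addrA addrK addNr.
apply: rpredB; last exact: enda_lie.
apply: rpredD; last exact: enda_lie.
apply/enda_com => a; rewrite endk_lie_lie !com_enda.
by rewrite endk_lie0l endk_lie0r addr0.
Qed.

(* The carrier of End(L, E) = End_A(E) (+) L; the curvature term gives a Lie
   bracket only under rho(D) = Id_E, whence the unused parameter. *)
Definition EndL of rho (dlie_D L) = 1 : Type := (enda i E * L)%type.
HB.instance Definition _ := GRing.Lmodule.on (EndL rhoD).
Implicit Types x y z : EndL rhoD.

Definition EndL_ract x a : EndL rhoD := (ract x.1 a, ract x.2 a).

Definition EndL_lie x y : EndL rhoD :=
  (Enda (EndL_lie_subproof x.1 y.1 x.2 y.2), lie x.2 y.2).

Lemma EndL_ext x y : x.1 = y.1 -> x.2 = y.2 -> x = y.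
Proof. by case: x y => [a u] [b v] /= -> ->. Qed.

Let ractDl' a : {morph EndL_ract^~ a : x y / x + y}.
Proof. by move=> x y; apply: EndL_ext; exact: ractDl. Qed.
Let ractDr' x : {morph EndL_ract x : a b / a + b}.
Proof. by move=> a b; apply: EndL_ext; exact: ractDr. Qed.
Let ract1' x : EndL_ract x 1 = x.
Proof. by apply: EndL_ext; exact: ract1. Qed.
Let ractA' x a b : EndL_ract (EndL_ract x a) b = EndL_ract x (a * b).
Proof. by apply: EndL_ext; exact: ractA. Qed.
Let ractZ' a x b : EndL_ract (a *: x) b = a *: EndL_ract x b.
Proof. by apply: EndL_ext; exact: ractZ. Qed.
Let ract_base' c x : EndL_ract x (i c) = i c *: x.
Proof. by apply: EndL_ext; exact: ract_base. Qed.
HB.instance Definition _ := Lmodule_isBimodule.Build k A i (EndL rhoD)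
  ractDl' ractDr' ract1' ractA' ractZ' ract_base'.

Let emb x : endk i E := (x.1 : endk i E) + rho x.2.
Let embD x y : emb (x + y) = emb x + emb y.
Proof. by rewrite /emb connD addrACA. Qed.
Let embZ a x : emb (a *: x) = a *: emb x.
Proof. by rewrite /emb connZ scalerDr. Qed.
Let emb0 : emb 0 = 0.
Proof. by rewrite /emb conn0 addr0. Qed.
Let emb_lie x y : emb (EndL_lie x y) = lie (emb x) (emb y).
Proof.
rewrite /emb -[(EndL_lie x y).2]/(lie x.2 y.2).
rewrite -[((EndL_lie x y).1 : endk i E)]/(lie (x.1 : endk i E) y.1
  + lie (rho x.2) y.1 - lie (rho y.2) x.1 + curvature x.2 y.2).
rewrite -[LHS]addrA [curvature _ _ + _]subrK -endk_antiC.
rewrite (lieDl ((y.1 : endk i E) + rho y.2) x.1 (rho x.2)).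
rewrite (lieDr (x.1 : endk i E) y.1 (rho y.2)) (lieDr (rho x.2) y.1 (rho y.2)).
by rewrite [RHS]addrACA [RHS]addrA.
Qed.
Let emb_ext x y : emb x = emb y -> x.2 = y.2 -> x = y.
Proof.
move=> + e2; rewrite /emb e2 => /addIr/val_inj e1; exact: EndL_ext.
Qed.

Let lieDl' z : {morph EndL_lie^~ z : x y / x + y}.
Proof.
by move=> x y; apply: emb_ext; rewrite ?embD ?emb_lie ?embD ?lieDl //=; exact: lieDl.
Qed.
Let lieDr' z : {morph EndL_lie z : x y / x + y}.
Proof.
by move=> x y; apply: emb_ext; rewrite ?embD ?emb_lie ?embD ?lieDr //=; exact: lieDr.
Qed.
Let lieZl' c x y : EndL_lie (i c *: x) y = i c *: EndL_lie x y.
Proof.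
by apply: emb_ext; rewrite ?embZ ?emb_lie ?embZ ?lieZl //=; exact: lieZl.
Qed.
Let lieZr' c x y : EndL_lie x (i c *: y) = i c *: EndL_lie x y.
Proof.
by apply: emb_ext; rewrite ?embZ ?emb_lie ?embZ ?lieZr //=; exact: lieZr.
Qed.
Let lie_alt' x : EndL_lie x x = 0.
Proof.
by apply: emb_ext; rewrite ?emb_lie ?emb0 ?lie_alt //=; exact: lie_alt.
Qed.
Let lie_jacobi' x y z : EndL_lie x (EndL_lie y z) + EndL_lie y (EndL_lie z x)
  + EndL_lie z (EndL_lie x y) = 0.
Proof.
apply: emb_ext; first by rewrite !embD !emb_lie emb0 lie_jacobi.
exact: lie_jacobi.
Qed.
HB.instance Definition _ := Bimodule_isLie.Build k A i (EndL rhoD)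
  lieDl' lieDr' lieZl' lieZr' lie_alt' lie_jacobi'.

Definition EndL_alpha x : D1 f := dlie_alpha x.2.
Definition EndL_pi x : der i := dlie_pi x.2.
Definition EndL_D : EndL rhoD := (0, dlie_D L).

Fact EndL_alpha_bimod : bimod_hom EndL_alpha.
Proof.
split=> [a x y|x a]; first exact: (dlie_alpha_bimod L).1.
exact: (dlie_alpha_bimod L).2.
Qed.
Fact EndL_alpha_lie : lie_hom EndL_alpha.
Proof. by move=> x y; apply: dlie_alpha_lie. Qed.
Fact EndL_pi_bimod : bimod_hom EndL_pi.
Proof.
split=> [a x y|x a]; first exact: (dlie_pi_bimod L).1.
exact: (dlie_pi_bimod L).2.
Qed.
Fact EndL_pi_lie : lie_hom EndL_pi.
Proof. by move=> x y; apply: dlie_pi_lie. Qed.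
Fact EndL_alpha_pi x : D1_proj (EndL_alpha x) = EndL_pi x.
Proof. exact: dlie_alpha_pi. Qed.
Fact EndL_D_central x : lie x EndL_D = 0.
Proof.
apply: emb_ext; last exact: dlie_D_central.
by rewrite emb_lie emb0 /emb /= add0r rhoD endk_lieE mulr1 mul1r subrr.
Qed.
Fact EndL_pi_D : EndL_pi EndL_D = 0.
Proof. exact: dlie_pi_D. Qed.
Fact EndL_ractE x c : ract x c = c *: x + (EndL_pi x c : A) *: EndL_D.
Proof.
apply: EndL_ext; last exact: dlie_ract.
rewrite -[LHS]/(ract x.1 c) -[RHS]/(c *: x.1 + (EndL_pi x c : A) *: 0).
rewrite scaler0 addr0; apply/val_inj/endk_ext => e.
by rewrite -[LHS]/(x.1 (c *: e)) endaP.
Qed.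
Fact EndL_leibniz x y c :
  lie x (c *: y) = c *: lie x y + (EndL_pi x c : A) *: y.
Proof.
apply: emb_ext; last exact: dlie_leibniz.
rewrite emb_lie embD !embZ emb_lie -scal_idM endk_antiC endk_lieM.
rewrite opprD -mulrN -endk_antiC -mulNr -endk_antiC !scal_idM; congr (_ + _).
by rewrite {1}/emb lieDl com_enda add0r com_conn scal_idM.
Qed.

Definition EndL_dlie : dlie f := DLie EndL_alpha_bimod EndL_alpha_lie
  EndL_pi_bimod EndL_pi_lie EndL_alpha_pi EndL_D_central EndL_pi_D
  EndL_ractE EndL_leibniz.

End EndL.

Section FreeAlgebra.
Variables (k : comPzRingType) (X : choiceType).

(* Noncommutative power series as functions on words; the free associative
   algebra freealg below is the subring of series of finite support. *)
Definition ncseries : Type := seq X -> k^o.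
HB.instance Definition _ := GRing.Lmodule.on ncseries.
Implicit Types p q r : ncseries.

Definition ncs_one : ncseries := fun w => (w == [::])%:R.
Definition ncs_mul p q : ncseries :=
  fun w => \sum_(j < (size w).+1) (p (take j w) : k) * q (drop j w).

Let shift x p : ncseries := fun w => p (x :: w).

Let mul_nil p q : ncs_mul p q [::] = (p [::] : k) * q [::].
Proof. by rewrite /ncs_mul big_ord_recl big_ord0 addr0. Qed.
Let mul_cons p q x w :
  ncs_mul p q (x :: w) = (p [::] : k) * q (x :: w) + ncs_mul (shift x p) q w.
Proof. by rewrite /ncs_mul big_ord_recl. Qed.
Let ncsD p q w : (p + q) w = p w + q w. Proof. by []. Qed.

Let mulDl : left_distributive ncs_mul +%R.
Proof.
move=> p q r; apply/funext => w; rewrite ncsD /ncs_mul -big_split.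
by apply: eq_bigr => j _; rewrite ncsD mulrDl.
Qed.
Let mulDr : right_distributive ncs_mul +%R.
Proof.
move=> p q r; apply/funext => w; rewrite ncsD /ncs_mul -big_split.
by apply: eq_bigr => j _; rewrite ncsD mulrDr.
Qed.
Let mulZl a p q : ncs_mul (a *: p) q = a *: ncs_mul p q.
Proof.
apply/funext => w; rewrite -[RHS]/((a : k) * ncs_mul p q w) /ncs_mul mulr_sumr.
by apply: eq_bigr => j _; rewrite mulrA.
Qed.
Let mulA : associative ncs_mul.
Proof.
move=> p q r; apply/funext => w; elim: w p q => [|x w IH] p q.
  by rewrite !mul_nil mulrA.
rewrite !mul_cons IH mul_nil mulrDr -!addrA mulrA; congr (_ + _).
have -> : shift x (ncs_mul p q) = (p [::]) *: shift x q + ncs_mul (shift x p) q.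
  by apply/funext => v; rewrite ncsD /shift mul_cons.
by rewrite mulDl mulZl ncsD.
Qed.
Let mul1 : left_id ncs_one ncs_mul.
Proof.
move=> q; apply/funext => -[|x w]; first by rewrite mul_nil mul1r.
rewrite mul_cons mul1r /ncs_mul big1 ?addr0 // => j _.
by rewrite -[shift _ _ _]/0%R mul0r.
Qed.
Let mulr1' : right_id ncs_one ncs_mul.
Proof.
move=> p; apply/funext => w; elim: w p => [|x w IH] p.
  by rewrite mul_nil mulr1.
by rewrite mul_cons IH mulr0 add0r.
Qed.
HB.instance Definition _ :=
  GRing.Zmodule_isPzRing.Build ncseries mulA mul1 mulr1' mulDl mulDr.

Definition fin_supp_pred : ncseries -> bool :=
  fun p => `[< exists s : seq (seq X), forall w, w \notin s -> p w = 0 >].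

Lemma fin_supp_predP : subring_closed fin_supp_pred.
Proof.
split=> [|p q|p q]; rewrite !unfold_in.
- by apply/asboolP; exists [:: [::]] => w; rewrite inE /= /GRing.one /= /ncs_one => /negPf->.
- move=> /asboolP[s hs] /asboolP[t ht]; apply/asboolP; exists (s ++ t) => w.
  rewrite mem_cat negb_or => /andP[ws wt].
  by rewrite -[LHS]/(p w - q w) hs // ht // subrr.
- move=> /asboolP[s hs] /asboolP[t ht]; apply/asboolP.
  exists [seq u ++ v | u <- s, v <- t] => w hw.
  apply: big1 => j _; have [us|us] := boolP (take j w \in s); last first.
    by rewrite hs // mul0r.
  have [vt|vt] := boolP (drop j w \in t); last by rewrite ht // mulr0.
  by case/negP: hw; apply/allpairsP; exists (take j w, drop j w);
    rewrite /= us vt cat_take_drop.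
Qed.
HB.instance Definition _ :=
  GRing.isSubringClosed.Build ncseries fin_supp_pred fin_supp_predP.

Lemma fin_supp_scaleP : GRing.scaler_closed fin_supp_pred.
Proof.
move=> a p; rewrite !unfold_in => /asboolP[s hs]; apply/asboolP; exists s.
by move=> w /hs; rewrite -[(a *: p) w]/((a : k) * p w) => ->; rewrite mulr0.
Qed.
HB.instance Definition _ :=
  GRing.isScaleClosed.Build k ncseries fin_supp_pred fin_supp_scaleP.

Record freealg := FreeAlg {fa_coef :> ncseries; _ : fa_coef \in fin_supp_pred}.
HB.instance Definition _ := [isSub for fa_coef].
HB.instance Definition _ := [Choice of freealg by <:].
HB.instance Definition _ := GRing.SubChoice_isSubPzRing.Build
  ncseries fin_supp_pred freealg fin_supp_predP.
HB.instance Definition _ := [SubZmodule_isSubLmodule of freealg by <:].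

Lemma fa_gen_subproof (x : X) :
  ((fun w => (w == [:: x])%:R) : ncseries) \in fin_supp_pred.
Proof.
rewrite unfold_in; apply/asboolP; exists [:: [:: x]] => w.
by rewrite inE => /negPf ->.
Qed.
Definition fa_gen (x : X) : freealg := FreeAlg (fa_gen_subproof x).

End FreeAlgebra.

Section TensorAlgebra.
Variables (k A : comPzRingType) (i : {rmorphism k -> A}) (M : lmodType A).

Definition multilinear_rel : set (freealg k M) :=
  [set fa_gen k (u + v) - fa_gen k u - fa_gen k v | u in setT & v in setT]
  `|` [set fa_gen k (i c *: u) - c *: fa_gen k u | c in setT & u in setT].

(* T_k(M), graded by word length: the words of length j, modulo k-multilinearity,
   span the j-th tensor power of M over k. *)
Definition tensor_alg := quotring multilinear_rel.
HB.instance Definition _ := GRing.PzRing.on tensor_alg.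

Definition tensor_in (u : M) : tensor_alg := qproj multilinear_rel (fa_gen k u).

(* the sum of the tensor powers of degree at most n *)
Definition tensor_fil (n : nat) : set tensor_alg :=
  [set qproj multilinear_rel p |
    p in [set p : freealg k M | forall w, (n < size w)%N -> fa_coef p w = 0]].

End TensorAlgebra.

Section Enveloping.
Variables (k A : comPzRingType) (i : {rmorphism k -> A}) (f : cocycle2 i).
Variable (L : dlie f).
Local Notation T := (tensor_alg i L).
Local Notation t := (@tensor_in _ _ i L).
Local Notation D := (dlie_D L).

Definition J1_rel : set T :=
  [set t D - 1]
  `|` [set t (a *: u) - t (a *: D) * t u | a in setT & u in setT]
  `|` [set t (ract v b) - t v * t (b *: D) | b in setT & v in setT].

Definition Uotimes := quotring J1_rel.
HB.instance Definition _ := GRing.PzRing.on Uotimes.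

Definition Uotimes_in (u : L) : Uotimes := qproj J1_rel (t u).

Definition commutator_rel : set Uotimes :=
  [set Uotimes_in u * Uotimes_in v - Uotimes_in v * Uotimes_in u
       - Uotimes_in (lie u v) | u in setT & v in setT].

Definition tUotimes := quotring commutator_rel.
HB.instance Definition _ := GRing.PzRing.on tUotimes.

Definition tUotimes_in (u : L) : tUotimes := qproj commutator_rel (Uotimes_in u).

Definition tUotimes_fil (n : nat) : set tUotimes :=
  [set qproj commutator_rel (qproj J1_rel x) | x in @tensor_fil _ _ i L n].

End Enveloping.

(* Main.v *)
(* In the enveloping ring U the elements a D form a commutative subring phi(A),
   and t(u) phi(a) - phi(a) t(u) lies in phi(A) while commutators of generators
   are linear in the generators: U is almost normalizing over A. A word in the
   generators may therefore be permuted at the cost of shorter words. With k as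
   coefficients this is almost commutativity; with A as coefficients and finitely
   many generators it allows Hilbert's basis argument: the leading coefficients
   (for the degree lexicographic order) of a left ideal form a family of ideals
   of A indexed by the monomials, monotone for divisibility, and by Dickson's
   lemma such a family is determined by finitely many of its members. Right ideals
   are left ideals of the converse ring, which is almost normalizing as well.
   End(L, E) is finitely generated because End_A(E) is: each generator of E gives
   an evaluation map to E, and these maps are jointly injective. *)

Require Import Defs.
From HB Require Import structures.
From mathcomp Require Import all_boot all_algebra.
From mathcomp Require Import mathcomp_extra boolp classical_sets functions.
Set Implicit Arguments.
Unset Strict Implicit.
Unset Printing Implicit Defensive.
Import GRing.Theory.
Local Open Scope ring_scope.
Local Open Scope classical_set_scope.

(** * Submodules and noetherian rings *)

Section Submodules.
Variables (R : pzRingType) (V : lmodType R).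
Implicit Types (S K : set V) (gs : seq V).

Definition submodule S := [/\ S 0,
  forall x y, S x -> S y -> S (x + y) & forall a x, S x -> S (a *: x)].

(** Generation is phrased by minimality among submodules, so an inclusion is proved by exhibiting a
    submodule that contains the generators. Lists are used because they concatenate. *)
Definition spanned_by S gs := (forall g, g \in gs -> S g) /\
  forall K, submodule K -> (forall g, g \in gs -> K g) -> S `<=` K.

Lemma submoduleN S x : submodule S -> S x -> S (- x).
Proof. by move=> [_ _ SZ] Sx; rewrite -scaleN1r; apply: SZ. Qed.

Lemma submoduleB S x y : submodule S -> S x -> S y -> S (x - y).
Proof.
by move=> Ssub Sx Sy; case: (Ssub) => _ SD _; apply: SD => //; apply: submoduleN.
Qed.

Lemma submoduleI S K : submodule S -> submodule K -> submodule (S `&` K).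
Proof.
move=> [S0 SD SZ] [K0 KD KZ]; split=> //.
- by move=> x y [Sx Kx] [Sy Ky]; split; [apply: SD|apply: KD].
- by move=> a x [Sx Kx]; split; [apply: SZ|apply: KZ].
Qed.

Lemma submodule_comb S n (c : 'I_n -> R) (g : 'I_n -> V) :
  submodule S -> (forall j, S (g j)) -> S (\sum_j c j *: g j).
Proof. by move=> [S0 SD SZ] Sg; elim/big_ind: _ => // j _; apply: SZ. Qed.

Lemma comb_submodule n (g : 'I_n -> V) :
  submodule [set \sum_j c j *: g j | c in [set: 'I_n -> R]].
Proof.
split=> [|_ _ [c _ <-] [d _ <-]|a _ [c _ <-]].
- by exists (fun=> 0) => //; apply: big1 => j _; rewrite scale0r.
- exists (fun j => c j + d j) => //; rewrite -big_split.
  by apply: eq_bigr => j _; rewrite scalerDl.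
- exists (fun j => a * c j) => //; rewrite scaler_sumr.
  by apply: eq_bigr => j _; rewrite scalerA.
Qed.

Lemma comb_gen n (g : 'I_n -> V) l :
  [set \sum_j c j *: g j | c in [set: 'I_n -> R]] (g l).
Proof.
exists (fun j => (j == l)%:R) => //; rewrite (bigD1 l) //= eqxx scale1r.
by rewrite big1 ?addr0 // => j /negPf ->; rewrite scale0r.
Qed.

Lemma spanned_by_comb S gs : submodule S -> spanned_by S gs ->
  exists n (g : 'I_n -> V), S = [set \sum_j c j *: g j | c in [set: 'I_n -> R]].
Proof.
move=> Ssub [Sgs Smin]; exists (size gs), (fun j => tnth (in_tuple gs) j).
apply/seteqP; split=> [|_ [c _ <-]]; last first.
  by apply: submodule_comb => // j; apply/Sgs/mem_tnth.
apply: Smin => [|g /(tnthP (in_tuple gs))[j ->]]; first exact: comb_submodule.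
exact: comb_gen.
Qed.

Lemma comb_spanned_by n (g : 'I_n -> V) :
  spanned_by [set \sum_j c j *: g j | c in [set: 'I_n -> R]]
    [seq g j | j <- enum 'I_n].
Proof.
split=> [_ /mapP[j _ ->]|K Ksub Kg _ [c _ <-]]; first exact: comb_gen.
by apply: submodule_comb => // j; apply: Kg; rewrite map_f ?mem_enum.
Qed.

Lemma spanned_fin_gen gs : spanned_by setT gs -> fin_gen V.
Proof.
move=> /spanned_by_comb[//|n [g gT]]; exists n, g => v.
by have : [set: V] v by []; rewrite gT => -[c _ <-]; exists c.
Qed.

Lemma fin_gen_spanned : fin_gen V -> exists gs, spanned_by setT gs.
Proof.
move=> [n [g gT]]; exists [seq g j | j <- enum 'I_n].
rewrite (_ : setT = [set \sum_j c j *: g j | c in [set: 'I_n -> R]]).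
  exact: comb_spanned_by.
by apply/seteqP; split=> // v _; have [c ->] := gT v; exists c.
Qed.

End Submodules.

Lemma fin_gen_pair (R : pzRingType) (V W : lmodType R) :
  fin_gen V -> fin_gen W -> fin_gen (V * W)%type.
Proof.
move=> /fin_gen_spanned[gs [_ gsT]] /fin_gen_spanned[hs [_ hsT]].
pose inV v : V * W := (v, 0); pose inW w : V * W := (0, w).
apply: (@spanned_fin_gen _ _ (map inV gs ++ map inW hs)).
split=> // K [K0 KD KZ] Kg [v w] _.
have -> : (v, w) = inV v + inW w by congr (_, _); rewrite /= ?addr0 ?add0r.
apply: (KD).
- apply: (gsT [set x | K (inV x)]) => // [|g ggs].
    split=> [//|x y Kx Ky|a x Kx] /=.
      by rewrite (_ : inV _ = inV x + inV y); [exact: KD|congr (_, _); rewrite addr0].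
    by rewrite (_ : inV _ = a *: inV x); [exact: KZ|congr (_, _); rewrite scaler0].
  by apply: Kg; rewrite mem_cat map_f.
- apply: (hsT [set x | K (inW x)]) => // [|g ggs].
    split=> [//|x y Kx Ky|a x Kx] /=.
      by rewrite (_ : inW _ = inW x + inW y); [exact: KD|congr (_, _); rewrite addr0].
    by rewrite (_ : inW _ = a *: inW x); [exact: KZ|congr (_, _); rewrite scaler0].
  by apply: Kg; rewrite mem_cat map_f ?orbT.
Qed.

Section Noetherian.
Variable R : pzRingType.

Lemma noetherian_spanned (I : set R) : left_noetherian R -> left_ideal I ->
  exists gs, spanned_by (I : set R^o) gs.
Proof.
by move=> nR /nR[n [g ->]]; eexists; exact: (comb_spanned_by (g : 'I_n -> R^o)).
Qed.

Lemma spanned_noetherian : (forall I : set R, left_ideal I ->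
  exists gs, spanned_by (I : set R^o) gs) -> left_noetherian R.
Proof. by move=> h I Iid; have [gs] := h I Iid; apply: spanned_by_comb. Qed.

(** The union of the chain is an ideal, and its finitely many generators all lie in one member. *)
Lemma noetherian_chain (I : nat -> set R) : left_noetherian R ->
  (forall n, left_ideal (I n)) -> {homo I : m n / (m <= n)%N >-> m `<=` n} ->
  exists N, forall n, I n `<=` I N.
Proof.
move=> nR Iid Imon.
have /(noetherian_spanned nR)[gs [gsI gsmin]] : left_ideal (\bigcup_n I n).
  split=> [|x y [m _ Ix] [n _ Iy]|a x [n _ Ix]].
  - by exists 0%N => //; have [] := Iid 0%N.
  - exists (maxn m n) => //; have [_ ID _] := Iid (maxn m n).
    by apply: ID; [apply: Imon Ix|apply: Imon Iy]; rewrite (leq_maxl, leq_maxr).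
  - by exists n => //; have [_ _ IM] := Iid n; apply: IM.
have [N gsN] : exists N, forall g, g \in gs -> I N g.
  elim: gs gsI {gsmin} => [|g gs IH] gsI; first by exists 0%N.
  have [h hgs|N gsN] := IH; first by apply: gsI; rewrite inE hgs orbT.
  have [|n _ ng] := gsI g; first by rewrite inE eqxx.
  exists (maxn n N) => h; rewrite inE => /predU1P[->|/gsN].
    by apply: Imon ng; rewrite leq_maxl.
  by apply: Imon; rewrite leq_maxr.
exists N => n x Ix; apply: (gsmin (I N) (Iid N) gsN); by exists n.
Qed.

(** Generators of the preimage of an ideal map to generators of the ideal. *)
Lemma noetherian_surj (S : pzRingType) (h : {rmorphism R -> S}) :
  range h = setT -> left_noetherian R -> left_noetherian S.
Proof.
move=> hT nR I [I0 ID IM].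
have [|n [g gE]] := nR (h @^-1` I).
  split=> [|x y Ix Iy|a x Ix]; rewrite /= ?rmorph0 ?rmorphD ?rmorphM //.
    exact: ID.
  exact: IM.
exists n, (h \o g); apply/seteqP; split=> [y Iy|_ [c _ <-]].
  have [x _ xy] : range h y by rewrite hT.
  have : (h @^-1` I) x by rewrite /= xy.
  rewrite gE => -[c _ cx]; exists (h \o c) => //.
  by rewrite -xy -cx rmorph_sum; apply: eq_bigr => j _; rewrite rmorphM.
have /choice[d dE] : forall j, exists x, h x = c j.
  by move=> j; have [x _ xc] : range h (c j); [rewrite hT|exists x].
have : (h @^-1` I) (\sum_j d j * g j) by rewrite gE; exists d.
rewrite /= rmorph_sum; congr I; apply: eq_bigr => j _.
by rewrite rmorphM dE.
Qed.

End Noetherian.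

(* Submodules of W generated modulo the kernel of W -> V: each generator of V
   contributes one ideal of leading coefficients. *)
Lemma spanned_mod_ker (R : pzRingType) (V W : lmodType R)
    (e : {linear W -> V}) (gs : seq V) (S : set W) :
  left_noetherian R -> spanned_by setT gs -> submodule S ->
  exists2 hs : seq W, forall h, h \in hs -> S h &
    forall K, submodule K -> (forall h, h \in hs -> K h) ->
      S `&` e @^-1` [set 0] `<=` K -> S `<=` K.
Proof.
move=> nR [_ gsT] Ssub.
pose sp (gs' : seq V) :=
  [set v : V | forall K, submodule K -> (forall g, g \in gs' -> K g) -> K v].
have sp_sub gs' : submodule (sp gs').
  split=> [K []//|x y Sx Sy K Ksub Kg|a x Sx K Ksub Kg]; have [_ KD KZ] := Ksub.
    by apply: KD; [apply: Sx|apply: Sy].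
  by apply: KZ; apply: Sx.
have Ssp : S `<=` e @^-1` sp gs by move=> s _ K Ksub Kg; exact: gsT.
elim: gs {gsT} S Ssub Ssp => [|g gs IH] S Ssub Ssp.
  exists [::] => // K Ksub _ SK s Ss; apply: SK; split=> //.
  apply: Ssp => //; split=> [//|x y -> ->|a x ->]; by rewrite (addr0, scaler0).
have [S0 SD SZ] := Ssub; have [sp0 spD spZ] := sp_sub gs.
(* The coefficients of [g] occurring in values of [e] on [S], modulo the span of the remaining
   generators. *)
pose J := [set a : R | exists2 s, S s & sp gs (e s - a *: g)].
have Jid : left_ideal J.
  split=> [|a b [s Ss sa] [t St tb]|a b [s Ss sb]].
  - by exists 0 => //; rewrite linear0 scale0r subrr.
  - by exists (s + t); [exact: SD|rewrite linearD scalerDl opprD addrACA; exact: spD].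
  - by exists (a *: s); [exact: SZ|rewrite linearZ -scalerA -scalerBr; exact: spZ].
have [js [jsJ jsmin]] := noetherian_spanned nR Jid.
have [hs0 hs0S hs0P] : exists2 hs0 : seq W, forall h, h \in hs0 -> S h & forall a : R,
    a \in js -> exists2 s, s \in hs0 & sp gs (e s - a *: g).
  elim: js jsJ {jsmin} => [|a js IHj] jsJ; first by exists [::].
  have [b b_js|hs0 hs0S hs0P] := IHj; first by apply: jsJ; rewrite inE b_js orbT.
  have [|s Ss sa] := jsJ a; first by rewrite inE eqxx.
  exists (s :: hs0) => [h|b]; rewrite inE => /predU1P[->//|].
  - exact: hs0S.
  - by exists s => //; rewrite inE eqxx.
  - by move=> /hs0P[t ht tb]; exists t => //; rewrite inE ht orbT.
(* The elements without [g]-component, to which the induction hypothesis applies. *)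
pose S' := S `&` e @^-1` sp gs.
have [|_ []//|hs hsS hsP] := IH S'.
  apply: submoduleI => //; split=> [|x y /= ex ey|a x /= ex].
  - by rewrite /= linear0.
  - by rewrite linearD; apply: spD.
  - by rewrite linearZ; apply: spZ.
exists (hs0 ++ hs) => [h|K Ksub Kh SK].
  by rewrite mem_cat => /orP[/hs0S//|/hsS[]].
have [K0 KD KZ] := Ksub.
have {hsP}S'K : S' `<=` K.
  apply: hsP => // [h hhs|s [[Ss _] se]]; last exact: SK.
  by apply: Kh; rewrite mem_cat hhs orbT.
(* The coefficients realised inside [K] form an ideal containing the generators of [J], hence all of
   [J]. *)
have JK : J `<=` [set a | exists2 s, (K `&` S) s & sp gs (e s - a *: g)].
  apply: jsmin => [|a /hs0P[s shs sa]]; last first.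
    by exists s => //; split; [apply: Kh; rewrite mem_cat shs|exact: hs0S].
  split=> [|a b [s [Ks Ss] sa] [t [Kt St] tb]|a b [s [Ks Ss] sb]].
  - by exists 0 => //; rewrite linear0 scale0r subrr.
  - by exists (s + t); [split; [exact: KD|exact: SD]
      |rewrite linearD scalerDl opprD addrACA; exact: spD].
  - by exists (a *: s); [split; [exact: KZ|exact: SZ]
      |rewrite linearZ -scalerA -scalerBr; exact: spZ].
move=> s Ss.
have [a sa] : exists a, sp gs (e s - a *: g).
  apply: (Ssp s Ss [set v | exists a, sp gs (v - a *: g)]) => [|h].
    split=> [|x y [a xa] [b yb]|a x [b xb]].
    - by exists 0; rewrite scale0r subrr.
    - by exists (a + b); rewrite scalerDl opprD addrACA; exact: spD.
    - by exists (a * b); rewrite -scalerA -scalerBr; exact: spZ.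
  rewrite inE => /predU1P[->|hgs]; first by exists 1; rewrite scale1r subrr.
  by exists 0; rewrite scale0r subr0 => M Msub; apply.
have [|t [Kt St] ta] := JK a; first by exists s.
(* [t] lies in [K] and has the same coefficient of [g] as [s], so [s - t] falls into [S']. *)
rewrite -[s](subrK t); apply: KD => //; apply: S'K; split.
  exact: submoduleB.
rewrite /= linearB; have -> : e s - e t = (e s - a *: g) - (e t - a *: g).
  by rewrite opprB addrA subrK.
exact: (submoduleB (sp_sub gs)).
Qed.

(** Induction on a list [es] of elements of [E]: finitely many endomorphisms generate modulo those
    vanishing on [es], and each further evaluation adds finitely many more by [spanned_mod_ker]. *)
Lemma fin_gen_enda (k A : comPzRingType) (i : {rmorphism k -> A})
    (E : lmodType A) :
  left_noetherian A -> fin_gen E -> fin_gen (enda i E).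
Proof.
move=> nA /fin_gen_spanned[gs gsT].
pose ev e (p : enda i E) : E := p e.
have evlin e : linear (ev e) by [].
pose evL e : {linear enda i E -> E} :=
  HB.pack (ev e) (GRing.isLinear.Build A _ _ _ (ev e) (evlin e)).
pose S (es : seq E) := [set p : enda i E | forall e, e \in es -> p e = 0].
have Ssub es : submodule (S es).
  split=> [//|p q Sp Sq e he|a p Sp e he].
    by rewrite -[LHS]/(p e + q e) Sp // Sq // addr0.
  by rewrite -[LHS]/(a *: p e) Sp // scaler0.
have gen es : exists2 hs : seq (enda i E), True & forall K, submodule K ->
    (forall h, h \in hs -> K h) -> S es `<=` K -> [set: enda i E] `<=` K.
  elim: es => [|e es [hs _ IH]]; first by exists [::] => // K _ _ SK p _; apply: SK.
  have [hs' _ hs'P] := spanned_mod_ker (evL e) nA gsT (Ssub es).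
  exists (hs ++ hs') => // K Ksub Kh SK; apply: IH => // [h hhs|].
    by apply: Kh; rewrite mem_cat hhs.
  apply: hs'P => // [h hhs|p [Sp pe]].
    by apply: Kh; rewrite mem_cat hhs orbT.
  by apply: SK => e'; rewrite inE => /predU1P[->//|]; exact: Sp.
have [hs _ hsP] := gen gs; apply: (@spanned_fin_gen _ _ hs); split=> // K Ksub Kh.
(* The zeros of [p] form a submodule of [E]; containing the generators, it is everything. *)
apply: hsP => // p Sp; rewrite (_ : p = 0); first by case: Ksub.
apply/val_inj/endk_ext => e.
have [_ /(_ [set e | p e = 0])] := gsT; apply=> //.
split=> [|x y /= px py|a x /= px]; first by apply: (addrI (p 0)); rewrite -endkD !addr0.
  by rewrite endkD px py addr0.
by rewrite endaP px scaler0.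
Qed.

(** * Dickson's lemma and the basis theorem *)

Section Dickson.
Variables (R : pzRingType) (X : eqType).
Implicit Types (J : seq X -> set R) (s w v : seq X).

(* Words up to permutation are the monomials of a commutative polynomial ring. *)
Definition monomial_ideals J := [/\ forall w, left_ideal (J w),
  forall w v, perm_eq w v -> J w `<=` J v & forall v w, J w `<=` J (v ++ w)].

(* Dickson's lemma, with values in the ideals of a noetherian ring. *)
Lemma monomial_ideals_finite J s : left_noetherian R -> monomial_ideals J ->
  exists t : seq (seq X), forall w, {subset w <= s} ->
    exists v v', [/\ v \in t, perm_eq w (v' ++ v) & J w `<=` J v].
Proof.
move=> nR; elim: s J => [|x s IH] J [Jid Jperm Jcat].
  exists [:: [::]] => -[|y w ws]; first by exists [::], [::]; split=> // a.
  by have := ws y; rewrite inE eqxx => /(_ isT).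
(* Slices by the exponent of [x]; for fixed [w] they increase with [n]. *)
pose Jn n w := J (nseq n x ++ w).
have Jn_mono w : {homo Jn^~ w : m n / (m <= n)%N >-> m `<=` n}.
  by move=> m n /subnK <-; rewrite /Jn nseqD -catA; exact: Jcat.
have Jn_ideals n : monomial_ideals (Jn n).
  split=> [w|w v wv|v w]; first exact: Jid.
    by apply: Jperm; rewrite perm_cat2l.
  by apply: subset_trans (Jcat v _) _; apply: Jperm; rewrite perm_catCA.
have /choice[tn tnP] : forall n, exists t : seq (seq X), forall w,
    {subset w <= s} ->
    exists v v', [/\ v \in t, perm_eq w (v' ++ v) & Jn n w `<=` Jn n v].
  by move=> n; apply: IH.
have [|t tP] := IH (fun w => \bigcup_n Jn n w).
  split=> [w|w v wv a [n _ Ja]|v w a [n _ Ja]]; last 2 first.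
  - by exists n => //; have [_ h _] := Jn_ideals n; apply: h Ja.
  - by exists n => //; have [_ _ h] := Jn_ideals n; apply: h.
  split=> [|a b [m _ Ja] [n _ Jb]|a b [n _ Jb]].
  - by exists 0%N => //; have [] := Jid (nseq 0 x ++ w).
  - exists (maxn m n) => //; have [_ JD _] := Jid (nseq (maxn m n) x ++ w).
    by apply: JD; [apply: Jn_mono Ja|apply: Jn_mono Jb];
      rewrite (leq_maxl, leq_maxr).
  - by exists n => //; have [_ _ JM] := Jid (nseq n x ++ w); apply: JM.
(* The chains at the finitely many [v] in [t] have all become stationary at a common [N]. *)
have [N NP] : exists N, forall v, v \in t -> forall n, Jn n v `<=` Jn N v.
  elim: (t) => [|v t' [N NP]]; first by exists 0%N.
  have [M MP] := noetherian_chain nR (fun n => Jid (nseq n x ++ v)) (Jn_mono v).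
  exists (maxn M N) => u; rewrite inE => /predU1P[->|ut] n.
    by apply: subset_trans (MP n) _; apply: Jn_mono; rewrite leq_maxl.
  by apply: subset_trans (NP u ut n) _; apply: Jn_mono; rewrite leq_maxr.
(* Monomials with at least [N] copies of [x] are governed by the slice [N] and the list [t]; those
   with fewer by one of the finitely many lists [tn n] with [n < N]. *)
exists ([seq nseq N x ++ v | v <- t] ++
  flatten [seq [seq nseq n x ++ v | v <- tn n] | n <- iota 0 N]) => w ws.
pose w0 := [seq y <- w | y != x].
have w0s : {subset w0 <= s}.
  by move=> y; rewrite mem_filter => /andP[/negPf yx /ws]; rewrite inE yx.
have ww0 : perm_eq w (nseq (count_mem x w) x ++ w0).
  rewrite -(perm_filterC (pred1 x)) perm_sym perm_cat2r.
  by rewrite -[in nseq _ _](@size_filter _ (pred1 x)) -(all_pred1P x _ _) ?filter_all.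
have [nN|Nn] := ltnP (count_mem x w) N.
  have [v [v' [vt w0v Jv]]] := tnP (count_mem x w) w0 w0s.
  exists (nseq (count_mem x w) x ++ v), v'; split.
  - rewrite mem_cat; apply/orP; right; apply/flatten_mapP.
    by exists (count_mem x w); rewrite ?mem_iota ?map_f.
  - by rewrite (perm_trans ww0) // perm_sym perm_catCA perm_cat2l perm_sym.
  - exact: subset_trans (Jperm _ _ ww0) Jv.
have [v [v' [vt w0v Jv]]] := tP w0 w0s.
exists (nseq N x ++ v), (nseq (count_mem x w - N) x ++ v'); split.
- by rewrite mem_cat map_f.
- rewrite (perm_trans ww0) // -{1}(subnK Nn) nseqD -!catA perm_cat2l.
  by rewrite perm_sym perm_catCA perm_cat2l perm_sym.
- apply: subset_trans (Jperm _ _ ww0) _ => a Ja.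
  by have [|n _] := Jv a; [exists (count_mem x w)|exact: NP].
Qed.

End Dickson.

(** * Combinations of words with coefficients on the left *)

Section WordSpan.
Variables (B R : pzRingType) (phi : {rmorphism B -> R}).
Variables (X : eqType) (u : X -> R).
Implicit Types (S : set (seq X)) (w v : seq X) (x y : X) (r : R).

Definition wordprod w : R := \prod_(x <- w) u x.

Inductive wordspan S : R -> Prop :=
| wordspan0 : wordspan S 0
| wordspanD a w r of S w & wordspan S r : wordspan S (phi a * wordprod w + r).

Lemma wordprod_nil : wordprod [::] = 1. Proof. exact: big_nil. Qed.
Lemma wordprod_cons x w : wordprod (x :: w) = u x * wordprod w.
Proof. exact: big_cons. Qed.
Lemma wordprod_cat v w : wordprod (v ++ w) = wordprod v * wordprod w.
Proof. exact: big_cat. Qed.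

Lemma wordspan_sub S S' : S `<=` S' -> wordspan S `<=` wordspan S'.
Proof. by move=> SS' r; elim=> [|a w ? /SS' ? _]; [left|right]. Qed.

Lemma wordspan_add S r s : wordspan S r -> wordspan S s -> wordspan S (r + s).
Proof.
by move=> + Ss; elim=> [|a w t Sw _ IH]; rewrite ?add0r // -addrA; right.
Qed.

Lemma wordspan_mon S a w : S w -> wordspan S (phi a * wordprod w).
Proof. by move=> Sw; rewrite -[_ * _]addr0; right=> //; left. Qed.

Lemma wordspan_coef S a : S [::] -> wordspan S (phi a).
Proof. by rewrite -[phi a]mulr1 -wordprod_nil; exact: wordspan_mon. Qed.

Lemma wordspan_letter S a x : S [:: x] -> wordspan S (phi a * u x).
Proof. by rewrite -[u x]mulr1 -wordprod_nil -wordprod_cons; exact: wordspan_mon. Qed.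

Lemma wordspan_word S w : S w -> wordspan S (wordprod w).
Proof. by rewrite -[wordprod w]mul1r -(rmorph1 phi); exact: wordspan_mon. Qed.

Lemma wordspan_elim S (P : R -> Prop) : P 0 -> (forall r s, P r -> P s -> P (r + s)) ->
  (forall a w, S w -> P (phi a * wordprod w)) ->
  forall r, wordspan S r -> P r.
Proof. by move=> P0 PD PS r; elim=> // a w s Sw _; apply: PD; exact: PS. Qed.

Lemma wordspanZ S a r : wordspan S r -> wordspan S (phi a * r).
Proof.
move: r; apply: wordspan_elim => [|r s hr hs|b w Sw]; first by rewrite mulr0; left.
  by rewrite mulrDr; exact: wordspan_add.
by rewrite mulrA -rmorphM; exact: wordspan_mon.
Qed.

Lemma wordspanN S r : wordspan S r -> wordspan S (- r).
Proof. by move=> /(wordspanZ (-1)); rewrite rmorphN1 mulN1r. Qed.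

Lemma wordspanB S r s : wordspan S r -> wordspan S s -> wordspan S (r - s).
Proof. by move=> Sr /wordspanN; exact: wordspan_add. Qed.

(** Congruence modulo a span is transitive; reorderings of words are carried out as chains of such
    congruences. *)
Lemma wordspan_trans S r s t :
  wordspan S (r - s) -> wordspan S (s - t) -> wordspan S (r - t).
Proof. by move=> Srs Sst; rewrite -(subrK s r) -addrA; exact: wordspan_add. Qed.

(** Right multiplication by a word does not touch the coefficients, so no commutation rule enters,
    unlike multiplication on the left. *)
Lemma wordspan_mulr S S' w r : (forall v, S v -> S' (v ++ w)) ->
  wordspan S r -> wordspan S' (r * wordprod w).
Proof.
move=> SS'; move: r; apply: wordspan_elim => [|r s hr hs|b v Sv].
- by rewrite mul0r; left.
- by rewrite mulrDl; exact: wordspan_add.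
- by rewrite -mulrA -wordprod_cat; apply/wordspan_mon/SS'.
Qed.

End WordSpan.

(** * The word-length filtration of an almost normalizing extension *)

Section AlmostNormalizing.
Variables (B : comPzRingType) (R : pzRingType) (phi : {rmorphism B -> R}).
Variables (X : eqType) (u : X -> R).
Implicit Types (w v z : seq X) (x y : X) (a b : B) (r s : R).

Local Notation U := (wordprod u).
Local Notation span := (wordspan phi u).

(* Strict inequality, so that wordfil 0 is the zero group. *)
Definition wordfil n := span [set w : seq X | (size w < n)%N].
Local Notation F := wordfil.

(* R is an almost normalizing extension of the image of phi, in the sense of
   McConnell and Robson. *)
Definition almost_normalizing := [/\ forall P : R -> Prop,
    (forall r s, P r -> P s -> P (r + s)) -> (forall r s, P r -> P s -> P (r * s)) ->
    (forall a, P (phi a)) -> (forall x, P (u x)) -> forall r, P r,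
  forall x a, exists b, u x * phi a - phi a * u x = phi b &
  forall x y, F 2 (u x * u y - u y * u x)].

Hypothesis nR : almost_normalizing.

Lemma wordfil0 r : F 0 r -> r = 0.
Proof. by case=> // a w s; rewrite /= ltn0. Qed.

Lemma wordfilW m n : (m <= n)%N -> F m `<=` F n.
Proof. by move=> mn; apply: wordspan_sub => w /= /leq_trans; apply. Qed.

Lemma wordfil_word w n : (size w < n)%N -> F n (U w).
Proof. exact: wordspan_word. Qed.

Lemma wordfil_mulr w n r : F n r -> F (n + size w) (r * U w).
Proof.
by apply: wordspan_mulr => v /=; rewrite size_cat ltn_add2r.
Qed.

(** Moving [u x] past a coefficient leaves an error [phi b], whose word is shorter than the main
    term. *)
Lemma wordfil_mull1 x n r : F n r -> F n.+1 (u x * r).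
Proof.
have [_ com _] := nR; move: r; apply: wordspan_elim => [|r s hr hs|a w /= wn].
- by rewrite mulr0; left.
- by rewrite mulrDr; exact: wordspan_add.
- have [b xa] := com x a.
  rewrite mulrA -(subrK (phi a * u x) (u x * _)) xa mulrDl -mulrA -wordprod_cons.
  by apply: wordspan_add; apply: wordspan_mon => //=; exact: ltnW.
Qed.

Lemma wordfil_mull w n r : F n r -> F (size w + n) (U w * r).
Proof.
move=> Fr; elim: w => [|x w IH]; first by rewrite wordprod_nil mul1r.
by rewrite wordprod_cons -mulrA addSn; exact: wordfil_mull1.
Qed.

(** Each exchange of a letter with a coefficient replaces that letter by a coefficient, so every
    error term is strictly shorter than [w]. *)
Lemma wordfil_comm_coef w a : F (size w) (U w * phi a - phi a * U w).
Proof.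
have [_ com _] := nR; elim: w => [|x w IH].
  by rewrite wordprod_nil mul1r mulr1 subrr; left.
rewrite wordprod_cons; apply: (@wordspan_trans _ _ _ _ _ _ _ (u x * phi a * U w)).
  by rewrite -2!mulrA -mulrBr; exact: wordfil_mull1.
have [b xa] := com x a; rewrite (mulrA (phi a)) -mulrBl xa.
by apply: wordspan_mon; rewrite /= ltnS.
Qed.

(** [x] passes the letters of [w] one at a time; each exchange replaces two letters by a combination
    of words of length at most one. *)
Lemma wordfil_comm1 x w : F (size w).+1 (u x * U w - U w * u x).
Proof.
have [_ _ com] := nR; elim: w => [|y w IH].
  by rewrite wordprod_nil mul1r mulr1 subrr; left.
rewrite wordprod_cons; apply: (@wordspan_trans _ _ _ _ _ _ _ (u y * u x * U w)).
  by rewrite mulrA -mulrBl; exact: (@wordfil_mulr _ 2).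
by rewrite -2!mulrA -mulrBr; exact: wordfil_mull1.
Qed.

(** The first letter of [w] is located in [v] and brought to the front by [wordfil_comm1]; the tails
    are handled by induction. *)
Lemma wordfil_perm w v : perm_eq w v -> F (size w) (U w - U v).
Proof.
elim: w v => [|x w IH] v wv.
  by move: wv; rewrite perm_sym => /perm_nilP ->; rewrite subrr; left.
have := perm_size wv; have : x \in v by rewrite -(perm_mem wv) inE eqxx.
move=> xv; case/splitPr: xv wv => v1 v2 wv; rewrite /= size_cat /= addnS => -[sw].
have {}wv : perm_eq w (v1 ++ v2).
  by rewrite -(perm_cons x) (perm_trans wv) // -cat1s perm_catCA.
apply: (@wordspan_trans _ _ _ _ _ _ _ (u x * U (v1 ++ v2))).
  by rewrite wordprod_cons -mulrBr; apply/wordfil_mull1/IH.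
rewrite 2!wordprod_cat wordprod_cons !mulrA -mulrBl sw -addSn.
exact/wordfil_mulr/wordfil_comm1.
Qed.

Lemma wordfilM m n r s : F m.+1 r -> F n.+1 s -> F (m + n).+1 (r * s).
Proof.
move=> + Fs; move: r; apply: wordspan_elim => [|r t hr ht|a w /= wm].
- by rewrite mul0r; left.
- by rewrite mulrDl; exact: wordspan_add.
- rewrite -mulrA; apply: wordspanZ; apply: wordfilW (wordfil_mull w Fs).
  by rewrite addnS ltnS leq_add2r.
Qed.

Lemma wordfil_comm m n r s :
  F m.+1 r -> F n.+1 s -> F (m + n) (r * s - s * r).
Proof.
move=> Fr Fs; move: r Fr; apply: wordspan_elim => [|r t hr ht|a w /= wm].
- by rewrite mul0r mulr0 subrr; left.
- by rewrite mulrDl mulrDr opprD addrACA; exact: wordspan_add.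
move: s Fs; apply: wordspan_elim => [|r t hr ht|b v /= vn].
- by rewrite mul0r mulr0 subrr; left.
- by rewrite mulrDl mulrDr opprD addrACA; exact: wordspan_add.
(* Up to shorter words, a product of monomials is the concatenated word with the product
   coefficient. It remains to exchange coefficients in the commutative [B] and to permute the
   word. *)
have aux c d w1 w2 : F (size w1 + size w2)
    (phi c * U w1 * (phi d * U w2) - phi (c * d) * U (w1 ++ w2)).
  rewrite wordprod_cat rmorphM (mulrA _ (phi d)) -(mulrA (phi c)).
  rewrite -(mulrA (phi c) (phi d)) (mulrA (phi d)) -(mulrA (phi c)) -mulrBr -mulrBl.
  by apply: wordspanZ; apply/wordfil_mulr/wordfil_comm_coef.
apply: (@wordfilW (size w + size v)); first exact: leq_add.
apply: wordspan_trans (aux _ _ _ _) _.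
apply: (@wordspan_trans _ _ _ _ _ _ _ (phi (b * a) * U (v ++ w))).
  rewrite mulrC -mulrBr; apply: wordspanZ; rewrite -size_cat.
  by apply: wordfil_perm; rewrite perm_catC.
by rewrite -[X in span _ X]opprB; apply: wordspanN; rewrite addnC; exact: aux.
Qed.

Lemma wordfil_exhaustive r : exists n, F n.+1 r.
Proof.
have [gen _ _] := nR; move: r; apply: gen => [r s [m Fr] [n Fs]|r s [m Fr] [n Fs]|a|x].
- by exists (maxn m n); apply: wordspan_add;
    [apply: wordfilW Fr|apply: wordfilW Fs]; rewrite ltnS (leq_maxl, leq_maxr).
- by exists (m + n)%N; exact: wordfilM.
- by exists 0%N; exact: wordspan_coef.
- by exists 1%N; rewrite -[u x]mul1r -(rmorph1 phi); exact: wordspan_letter.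
Qed.

Lemma wordspanT r : span setT r.
Proof. by have [n] := wordfil_exhaustive r; apply: wordspan_sub. Qed.

Lemma wordfil_almost_commutative : almost_commutative (fun n => F n.+1).
Proof.
split; last first.
  (* The shift by one matters here: for [m + n = 0] the commutator lies in [F 0] and is therefore
     zero. *)
  move=> m n r s Fr Fs; have := wordfil_comm Fr Fs.
  by case: (m + n)%N => [|p] //; exact: wordfil0.
split=> [n|||m n r s|].
- by split=> [|r s]; [left|exact: wordspanB].
- by rewrite -[1](wordprod_nil u); exact: wordfil_word.
- by move=> n; exact: wordfilW.
- exact: wordfilM.
- by apply/seteqP; split=> // r _; have [n Fr] := wordfil_exhaustive r; exists n.
Qed.

End AlmostNormalizing.

(** * The degree lexicographic order on monomials *)

Section Deglex.
Variable X : finType.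
Implicit Types (s w v : seq X).

(** Lexicographic comparison of exponent vectors: only letter counts enter, so this orders monomials
    rather than words. *)
Fixpoint count_lt s w v := if s is x :: s' then
    (count_mem x w < count_mem x v)%N ||
    ((count_mem x w == count_mem x v) && count_lt s' w v)
  else false.

Definition deglex w v :=
  (size w < size v)%N || ((size w == size v) && count_lt (enum X) w v).

Lemma count_lt_cat s z w v : count_lt s (z ++ w) (z ++ v) = count_lt s w v.
Proof. by elim: s => //= x s ->; rewrite !count_cat ltn_add2l eqn_add2l. Qed.

Lemma deglex_cat z w v : deglex (z ++ w) (z ++ v) = deglex w v.
Proof. by rewrite /deglex !size_cat ltn_add2l eqn_add2l count_lt_cat. Qed.

Lemma count_lt_perm s w v v' : perm_eq v v' -> count_lt s w v = count_lt s w v'.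
Proof. by move=> /permP vv'; elim: s => //= x s ->; rewrite vv'. Qed.

Lemma deglex_perm w v v' : perm_eq v v' -> deglex w v = deglex w v'.
Proof. by move=> vv'; rewrite /deglex (perm_size vv') (count_lt_perm _ _ vv'). Qed.

Lemma count_lt_trans s : transitive (count_lt s).
Proof.
move=> v w z; elim: s => //= x s IH /orP[wv|/andP[/eqP-> wv]] /orP[vz|/andP[/eqP<- vz]].
- by rewrite (ltn_trans wv vz).
- by rewrite wv.
- by rewrite vz.
- by rewrite eqxx IH ?orbT.
Qed.

Lemma deglex_trans : transitive deglex.
Proof.
move=> v w z /orP[wv|/andP[/eqP wv cwv]] /orP[vz|/andP[/eqP vz cvz]]; rewrite /deglex.
- by rewrite (ltn_trans wv vz).
- by rewrite -vz wv.
- by rewrite wv vz.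
- by rewrite wv vz eqxx (count_lt_trans cwv cvz) orbT.
Qed.

(** Words that are incomparable have equal counts for every letter, hence are permutations of each
    other. *)
Lemma deglex_total w v : [|| perm_eq w v, deglex w v | deglex v w].
Proof.
rewrite /deglex; case: (ltngtP (size w) (size v)) => //= [||_]; rewrite ?orbT //.
suff : forall s, [|| all (fun x => count_mem x w == count_mem x v) s,
    count_lt s w v | count_lt s v w].
  move=> /(_ (enum X)) /orP[/allP h|->]; rewrite ?orbT //.
  by apply/orP; left; apply/allP => x _ /=; apply: h; rewrite mem_enum.
by elim=> //= x s IH; case: ltngtP; rewrite /= ?orbT.
Qed.

(** Strong induction on the value of [f], and for a fixed value induction on accessibility for
    [r]. *)
Lemma lex_wf (T : Type) (f : T -> nat) (r : rel T) : well_founded r ->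
  well_founded (fun a b => (f a < f b)%N || ((f a == f b) && r a b)).
Proof.
move=> rwf a; move En: (f a) => n; elim/ltn_ind: n a En => n IHn a.
elim: (rwf a) => {}a _ IHa En; constructor => b /orP[ba|/andP[/eqP ba rba]].
  by apply: (IHn (f b)); rewrite -?En.
by apply: IHa => //; rewrite ba.
Qed.

(** [deglex] is an iterated lexicographic product over the length and the letter counts, starting
    from the empty relation. *)
Lemma deglex_wf : well_founded deglex.
Proof.
by apply: lex_wf; elim: (enum X) => [w|x s IH]; [constructor|apply: lex_wf].
Qed.

End Deglex.

(** * Leading coefficients and Hilbert's basis argument *)

Section HilbertBasis.
Variables (B : comPzRingType) (R : pzRingType) (phi : {rmorphism B -> R}).
Variables (X : finType) (u : X -> R).
Implicit Types (I K : set R) (w v z : seq X) (a b : B) (r s : R).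

Local Notation U := (wordprod u).
Local Notation span := (wordspan phi u).
Local Notation F := (wordfil phi u).

Hypothesis nR : almost_normalizing phi u.

Let lower w := span [set v : seq X | deglex v w].

Definition lead_coefs I w := [set a | exists2 r, lower w r & I (phi a * U w + r)].

Let wordfil_lower w : F (size w) `<=` lower w.
Proof. by apply: wordspan_sub => v /= vw; rewrite /deglex vw. Qed.

(** The order is invariant under concatenation, and commuting [U v] past a coefficient only adds
    words shorter than [v ++ w]. *)
Let lower_mull v w r : lower w r -> lower (v ++ w) (U v * r).
Proof.
move: r; apply: wordspan_elim => [|r s hr hs|a z /= zw].
- by rewrite mulr0; left.
- by rewrite mulrDr; exact: wordspan_add.
rewrite mulrA -(subrK (phi a * U v) (U v * _)) mulrDl -mulrA -wordprod_cat.
apply: wordspan_add; last by apply: wordspan_mon; rewrite /= deglex_cat.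
apply: wordfil_lower; apply: wordfilW (wordfil_mulr z (wordfil_comm_coef nR v a)).
rewrite size_cat leq_add2l.
by case/orP: zw => [/ltnW//|/andP[/eqP ->]].
Qed.

(** Permuting a leading word changes the element by shorter words only; for divisibility, an element
    of [I] is multiplied on the left by [U v]. *)
Lemma lead_coefs_ideals I : left_ideal I -> monomial_ideals (lead_coefs I).
Proof.
move=> [I0 ID IM]; split=> [w|w v wv a [r lr Ir]|v w a [r lr Ir]].
- split=> [|a b [r lr Ir] [s ls Is]|a b [r lr Ir]].
  + by exists 0; rewrite ?rmorph0 ?mul0r ?addr0 //; left.
  + exists (r + s); first exact: wordspan_add.
    by rewrite rmorphD mulrDl addrACA; exact: ID.
  + exists (phi a * r); first exact: wordspanZ.
    by rewrite rmorphM -mulrA -mulrDr; exact: IM.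
- exists (phi a * (U w - U v) + r); last by rewrite addrA -mulrDr subrKC.
  apply: wordspan_add.
    apply: wordspanZ; apply: wordfil_lower; rewrite -(perm_size wv).
    exact: wordfil_perm.
  by apply: wordspan_sub lr => z /=; rewrite (deglex_perm _ wv).
- exists (U v * (phi a * U w + r) - phi a * U (v ++ w)); last first.
    by rewrite subrKC; exact: IM.
  rewrite mulrDr addrAC; apply: wordspan_add; last exact: lower_mull.
  rewrite wordprod_cat !mulrA -mulrBl; apply: wordfil_lower; rewrite size_cat.
  by apply/wordfil_mulr/wordfil_comm_coef.
Qed.

(** Terms are merged one by one, comparing leading words by [deglex_total]. Words may be linearly
    dependent in [R], so the leading term is not unique, and its coefficient may be zero. *)
Lemma wordspan_lead S r : span S r ->
  r = 0 \/ exists v a s, [/\ S v, lower v s & r = phi a * U v + s].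
Proof.
have lowerW v v' s : deglex v v' -> lower v s -> lower v' s.
  by move=> vv'; apply: wordspan_sub => z /= /deglex_trans; exact.
elim=> [|a z {}r Sz _ [->|[v [b [s [Sv ls ->]]]]]]; first by left.
  by right; exists z, a, 0; split=> //; left.
right; case/or3P: (deglex_total z v) => [zv|zv|vz].
- exists v, (a + b), (phi a * (U z - U v) + s); split=> //; last first.
    by rewrite rmorphD mulrDl addrACA -mulrDr subrKC.
  apply: wordspan_add ls; apply: wordspanZ; apply: wordfil_lower.
  by rewrite -(perm_size zv); exact: wordfil_perm.
- exists v, b, (phi a * U z + s); split=> //; last by rewrite addrCA.
  by apply: wordspan_add ls; exact: wordspan_mon.
- exists z, a, (phi b * U v + s); split=> //.
  by apply: wordspan_add (lowerW _ _ _ vz ls); exact: wordspan_mon.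
Qed.

Let lead_coefs_sub I K : left_ideal I -> left_ideal K -> K `<=` I ->
  (forall w, lead_coefs I w `<=` lead_coefs K w) -> I `<=` K.
Proof.
move=> Iid [K0 KD _] KI lIK.
(* Division step: subtracting an element of [K] with the same leading term leaves a lower remainder,
   still in [I] since [K] is contained in [I]. *)
have step v a s : lower v `&` I `<=` K -> lower v s -> I (phi a * U v + s) ->
    K (phi a * U v + s).
  move=> lK ls Is; have [|t lt Kt] := lIK v a; first by exists s.
  rewrite -(subrK (phi a * U v + t) (_ + s)); apply: KD => //; apply: lK; split.
    by rewrite opprD addrACA subrr add0r; exact: wordspanB.
  exact: (@submoduleB _ R^o) Iid Is (KI _ Kt).
have low w : lower w `&` I `<=` K.
  elim/(well_founded_ind (@deglex_wf X)): w => w IH r [lr].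
  have [->//|[v [a [s [vw ls ->]]]]] := wordspan_lead lr.
  exact/step/ls/IH.
by move=> r; have /wordspan_lead[->//|[v [a [s [_ ls ->]]]]] := wordspanT nR r; exact: step.
Qed.

Lemma almost_normalizing_noetherian : left_noetherian B -> left_noetherian R.
Proof.
move=> nB; apply: spanned_noetherian => I Iid.
have [lJ _ _] := lead_coefs_ideals Iid.
have [t tP] := monomial_ideals_finite (enum X) nB (lead_coefs_ideals Iid).
(* For each of the finitely many [v] in [t], generators of the ideal of leading coefficients are
   lifted to elements of [I]. *)
have [gs gsI gsP] : exists2 gs : seq R, forall g, g \in gs -> I g &
    forall K, left_ideal K -> (forall g, g \in gs -> K g) ->
    forall v, v \in t -> lead_coefs I v `<=` lead_coefs K v.
  elim: (t) => [|v t' [gs gsI gsP]]; first by exists [::].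
  have [js [jsJ jsmin]] := noetherian_spanned nB (lJ v).
  have [hs hsI hsP] : exists2 hs : seq R, forall h, h \in hs -> I h &
      forall K, (forall h, h \in hs -> K h) ->
      forall a : B, a \in js -> lead_coefs K v a.
    elim: js jsJ {jsmin} => [|a js IH] jsJ; first by exists [::].
    have [b bjs|hs hsI hsP] := IH; first by apply: jsJ; rewrite inE bjs orbT.
    have [|r lr Ir] := jsJ a; first by rewrite inE eqxx.
    exists (phi a * U v + r :: hs) => [h|K Kh b].
      by rewrite inE => /predU1P[->//|/hsI].
    rewrite inE => /predU1P[->|bjs]; first by
      exists r => //; apply: Kh; rewrite inE eqxx.
    by apply: hsP bjs => h hhs; apply: Kh; rewrite inE hhs orbT.
  exists (hs ++ gs) => [g|K Kid Kg w].
    by rewrite mem_cat => /orP[/hsI|/gsI].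
  rewrite inE => /predU1P[->|]; last first.
    by apply: gsP => // g ggs; apply: Kg; rewrite mem_cat ggs orbT.
  have [lK _ _] := lead_coefs_ideals Kid.
  apply: jsmin; first exact: lK.
  by apply: hsP => h hhs; apply: Kg; rewrite mem_cat hhs.
exists gs; split=> // K Kid Kgs.
(* The division argument compares [I] with a smaller ideal, so [K] is first intersected with [I]. *)
have KIid : left_ideal (K `&` I) by exact: (@submoduleI _ R^o).
suff : I `<=` K `&` I by move=> h r /h[].
apply: lead_coefs_sub => // w a Ja.
(* Up to permutation [w] is a multiple of some [v] in [t] whose ideal contains the one at [w]; the
   coefficient is found at [v] and carried back to [w]. *)
have [|v [v' [vt wv JwJv]]] := tP w; first by move=> x _; rewrite mem_enum.
have [_ lperm lcat] := lead_coefs_ideals KIid.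
apply: (lperm (v' ++ v)); first by rewrite perm_sym.
by apply/lcat/(gsP _ KIid _ v vt)/JwJv => // g ggs; split; [exact: Kgs|exact: gsI].
Qed.

End HilbertBasis.

(** * Right ideals through the converse ring *)

Section Converse.
Variables (B : comPzRingType) (R : pzRingType) (phi : {rmorphism B -> R}).
Variables (X : finType) (u : X -> R).

Definition conv_rmorph : B -> R^c := phi.

Lemma conv_rmorph_zmod : zmod_morphism conv_rmorph.
Proof. exact: (rmorphB phi). Qed.
Lemma conv_rmorph_monoid : monoid_morphism conv_rmorph.
Proof.
split=> [|a b]; first exact: (rmorph1 phi).
by rewrite mulrC; exact: (rmorphM phi).
Qed.
HB.instance Definition _ :=
  GRing.isZmodMorphism.Build B R^c conv_rmorph conv_rmorph_zmod.
HB.instance Definition _ :=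
  GRing.isMonoidMorphism.Build B R^c conv_rmorph conv_rmorph_monoid.

(** In the converse ring coefficients stand on the wrong side, but a commutator of generators
    involves words of length at most one, so exchanging one letter with one coefficient repairs each
    term. *)
Lemma almost_normalizing_conv : almost_normalizing phi u ->
  almost_normalizing conv_rmorph (u : X -> R^c).
Proof.
move=> [gen com ucom]; split=> [P PD PM|x a|x y].
- by apply: gen => // r s Pr Ps; exact: (PM s r).
- have [b xa] := com x a; exists (- b).
  rewrite rmorphN; change (phi a * u x - u x * phi a = - phi b).
  by rewrite -xa opprB.
- change (wordfil conv_rmorph (u : X -> R^c) 2 (u y * u x - u x * u y)).
  move: (_ - _) (ucom y x) => r; apply: wordspan_elim => [|s t|a w w2].
  + exact: (wordspan0 conv_rmorph).
  + exact: (@wordspan_add _ R^c).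
  case: w w2 => [|z [|//]] _.
    by rewrite wordprod_nil mulr1; exact: (@wordspan_coef _ R^c conv_rmorph).
  have [b za] := com z a; rewrite wordprod_cons wordprod_nil mulr1.
  have -> : phi a * u z = u z * phi a - phi b by rewrite -za opprB subrKC.
  apply: (@wordspanB _ R^c).
    exact: (@wordspan_letter _ R^c conv_rmorph).
  exact: (@wordspan_coef _ R^c conv_rmorph).
Qed.

Lemma hilbert_basis : almost_normalizing phi u -> left_noetherian B -> noetherian R.
Proof.
move=> nR nB; split; first exact: almost_normalizing_noetherian nR nB.
have nRc := almost_normalizing_noetherian (almost_normalizing_conv nR) nB.
by move=> I Iid; exact: (nRc I Iid).
Qed.

End Converse.

Lemma noetherian_image (R S : pzRingType) (h : {rmorphism R -> S}) :
  range h = setT -> noetherian R -> noetherian S.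
Proof.
move=> hT [lR rR]; split; first exact: noetherian_surj hT lR.
pose hc : R^c -> S^c := h.
have zm : zmod_morphism hc by exact: (rmorphB h).
have mm : monoid_morphism hc.
  by split=> [|a b]; [exact: (rmorph1 h)|exact: (rmorphM h)].
pose hcm : {rmorphism R^c -> S^c} := HB.pack hc
  (GRing.isZmodMorphism.Build R^c S^c hc zm)
  (GRing.isMonoidMorphism.Build R^c S^c hc mm).
by move=> I Iid; exact: (@noetherian_surj R^c S^c hcm hT rR I Iid).
Qed.

(** * The enveloping algebra *)

(** The kernel of [h] is a two-sided ideal containing [G], so evaluating [h] on representatives is
    independent of their choice. *)
Lemma quotring_lift (R S : pzRingType) (G : set R) (h : {rmorphism R -> S}) :
  (forall x, G x -> h x = 0) ->
  exists h' : {rmorphism quotring G -> S}, forall x, h' (qproj G x) = h x.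
Proof.
move=> hG; have hI x : ideal_gen G x -> h x = 0.
  move=> /(_ [set y | h y = 0]); apply; split=> //.
  split; split=> [|y z /= hy hz|a y /= hy]; rewrite /= ?rmorph0 //;
    by rewrite ?rmorphD ?rmorphM ?hy ?hz ?(addr0, mulr0, mul0r).
pose h' (x : quotring G) := h (repr x).
have h'E x : h' (qproj G x) = h x.
  apply/eqP; rewrite -subr_eq0 -rmorphB; apply/eqP/hI/asboolP.
  by rewrite -[X in is_true X]/(_ \in ideal_pred G) -qprojP qreprK.
have zm : zmod_morphism h'.
  by move=> x y; rewrite -[x]qreprK -[y]qreprK -rmorphB !h'E rmorphB.
have mm : monoid_morphism h'.
  split=> [|x y]; first by rewrite -(rmorph1 (qproj G)) h'E rmorph1.
  by rewrite -[x]qreprK -[y]qreprK -rmorphM !h'E rmorphM.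
pose hm : {rmorphism quotring G -> S} := HB.pack h'
  (GRing.isZmodMorphism.Build _ _ h' zm) (GRing.isMonoidMorphism.Build _ _ h' mm).
by exists hm => x; exact: h'E.
Qed.

Lemma qproj_eq0 (R : pzRingType) (G : set R) x : G x -> qproj G x = 0.
Proof.
move=> Gx; rewrite -(rmorph0 (qproj G)); apply/eqP; rewrite qprojP subr0.
by apply/asboolP => I [_]; apply.
Qed.

(** * The free algebra: basis of words and universal property *)

Section FreeAlgebraTheory.
Variables (k : comPzRingType) (X : choiceType).
Implicit Types (p q : freealg k X) (w v : seq X) (x : X) (c : k).

Local Notation word := (wordprod (@fa_gen k X)).
Local Notation coef p w := (fa_coef p w : k).

Lemma fa_ext p q : (forall w, coef p w = coef q w) -> p = q.
Proof. by move=> pq; apply/val_inj/funext. Qed.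

Lemma fa_coefD p q w : coef (p + q) w = coef p w + coef q w. Proof. by []. Qed.
Lemma fa_coefZ c p w : coef (c *: p) w = c * coef p w. Proof. by []. Qed.
Lemma fa_coefM p q w :
  coef (p * q) w = \sum_(j < (size w).+1) coef p (take j w) * coef q (drop j w).
Proof. by []. Qed.

Lemma fa_coef_gen x w : coef (fa_gen k x) w = (w == [:: x])%:R.
Proof. by []. Qed.

Lemma fa_coef_sum (I : Type) (s : seq I) (F : I -> freealg k X) w :
  coef (\sum_(j <- s) F j) w = \sum_(j <- s) coef (F j) w.
Proof. by elim/big_rec2: _ => // j r p _ <-; rewrite fa_coefD. Qed.

Lemma fa_scaleAl c p q : c *: (p * q) = (c *: p) * q.
Proof.
apply: fa_ext => w; rewrite fa_coefZ !fa_coefM mulr_sumr.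
by apply: eq_bigr => j _; rewrite fa_coefZ mulrA.
Qed.

Lemma fa_scaleAr c p q : c *: (p * q) = p * (c *: q).
Proof.
apply: fa_ext => w; rewrite fa_coefZ !fa_coefM mulr_sumr.
by apply: eq_bigr => j _; rewrite fa_coefZ mulrCA.
Qed.

Lemma fa_coef_word w v : coef (word w) v = (v == w)%:R.
Proof.
elim: w v => [|x w IH] [|y v]; rewrite ?wordprod_nil // wordprod_cons fa_coefM.
  by rewrite big_ord_recl big_ord0 addr0 /= mul0r.
(* Only the split after one letter can contribute, as the generator vanishes on all other
   prefixes. *)
rewrite 2!big_ord_recl big1 ?addr0 => [|j _]; last first.
  case: v j => [|z v] [j jv]; first by [].
  by rewrite fa_coef_gen /= eqseq_cons andbF mul0r.
rewrite !fa_coef_gen /= mul0r add0r take0 drop0 IH !eqseq_cons andbT.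
by case: (y == x); rewrite /= ?mul1r ?mul0r.
Qed.

(** A chosen list containing the support; it may also contain words with zero coefficient. *)
Definition fa_support p : seq (seq X) :=
  undup (projT1 (cid (asboolW (valP p)))).

Lemma fa_support_coef p w : w \notin fa_support p -> coef p w = 0.
Proof. by rewrite /fa_support mem_undup; case: cid => s /= sP /sP. Qed.

Lemma fa_expand p s : uniq s -> (forall w, w \notin s -> coef p w = 0) ->
  p = \sum_(w <- s) coef p w *: word w.
Proof.
move=> s_uniq sp; apply: fa_ext => v; rewrite fa_coef_sum.
have [vs|vs] := boolP (v \in s).
  rewrite (bigD1_seq v) // big1 => [|w].
    by rewrite Monoid.mulm1 fa_coefZ fa_coef_word eqxx mulr1.
  by rewrite eq_sym fa_coefZ fa_coef_word => /negPf ->; rewrite mulr0.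
rewrite sp // big_seq big1 // => w ws; rewrite fa_coefZ fa_coef_word.
by case: eqP ws vs => [->|_ _ _]; [move->|rewrite mulr0].
Qed.

(** The morphism is read off the expansion in words; centrality of the image of [i] makes it
    multiplicative. *)
Lemma fa_lift (S : pzRingType) (i : {rmorphism k -> S}) (g : X -> S) :
  (forall c s, i c * s = s * i c) ->
  exists h : {rmorphism freealg k X -> S},
    (forall x, h (fa_gen k x) = g x) /\ forall c p, h (c *: p) = i c * h p.
Proof.
move=> iC; pose h p := \sum_(w <- fa_support p) i (coef p w) * wordprod g w.
(* Only nonzero coefficients contribute, so the value can be computed on any list containing the
   support, in particular on one common to two elements. *)
have hE p s : uniq s -> (forall w, w \notin s -> coef p w = 0) ->
    h p = \sum_(w <- s) i (coef p w) * wordprod g w.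
  have nz t : \sum_(w <- t) i (coef p w) * wordprod g w =
      \sum_(w <- [seq w <- t | coef p w != 0]) i (coef p w) * wordprod g w.
    rewrite big_filter [LHS](bigID (fun w => coef p w != 0)) /= addrC.
    rewrite big1 ?add0r // => w.
    by rewrite negbK => /eqP ->; rewrite rmorph0 mul0r.
  move=> s_uniq sp; rewrite /h nz (nz s); apply: perm_big.
  apply: uniq_perm; rewrite ?filter_uniq ?undup_uniq // => w.
  rewrite !mem_filter; case: eqP => //= pw; apply/idP/idP => _; apply: contra_notT pw.
    exact: sp.
  exact: fa_support_coef.
have hD p q : h (p + q) = h p + h q.
  pose s := undup (fa_support p ++ fa_support q).
  have sp w : w \notin s -> coef p w = 0 /\ coef q w = 0.
    rewrite mem_undup mem_cat negb_or => /andP[wp wq].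
    by rewrite !fa_support_coef.
  rewrite !(hE _ s) ?undup_uniq // => [|w /sp[]//|w /sp[]//|w /sp[pw qw]]; last first.
    by rewrite fa_coefD pw qw addr0.
  by rewrite -big_split; apply: eq_bigr => w _; rewrite fa_coefD rmorphD mulrDl.
have hZ c p : h (c *: p) = i c * h p.
  rewrite (hE _ (fa_support p)) ?undup_uniq // => [|w /fa_support_coef pw]; last first.
    by rewrite fa_coefZ pw mulr0.
  by rewrite mulr_sumr; apply: eq_bigr => w _; rewrite fa_coefZ rmorphM mulrA.
have hw w : h (word w) = wordprod g w.
  rewrite (hE _ [:: w]) // => [|v]; last by rewrite inE fa_coef_word => /negPf ->.
  by rewrite big_seq1 fa_coef_word eqxx rmorph1 mul1r.
have h0 : h 0 = 0 by apply: (addrI (h 0)); rewrite -hD !addr0.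
have hS (I : Type) (r : seq I) (P : I -> freealg k X) :
    h (\sum_(j <- r) P j) = \sum_(j <- r) h (P j).
  exact: (big_morph h hD h0).
have zm : zmod_morphism h.
  move=> p q; rewrite hD -scaleN1r hZ rmorphN1 mulN1r //.
have mm : monoid_morphism h.
  split=> [|p q]; first by rewrite -(wordprod_nil (@fa_gen k X)) hw wordprod_nil.
  have exp r := fa_expand (undup_uniq _) (@fa_support_coef r).
  rewrite [in LHS](exp p) [in LHS](exp q) mulr_suml hS [h p]/h mulr_suml.
  apply: eq_bigr => w _; rewrite mulr_sumr hS [h q]/h mulr_sumr.
  apply: eq_bigr => v _.
  rewrite -fa_scaleAl -fa_scaleAr -wordprod_cat !hZ hw wordprod_cat.
  by rewrite -mulrA; congr (_ * _); rewrite !mulrA iC.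
pose hm : {rmorphism freealg k X -> S} := HB.pack h
  (GRing.isZmodMorphism.Build _ _ h zm) (GRing.isMonoidMorphism.Build _ _ h mm).
exists hm; split=> // x.
by have := hw [:: x]; rewrite !wordprod_cons !wordprod_nil !mulr1.
Qed.

End FreeAlgebraTheory.

(** * Relations, filtration and universal property of the enveloping ring *)

Section EnvelopingTheory.
Variables (k A : comPzRingType) (i : {rmorphism k -> A}) (f : cocycle2 i).
Variable L : dlie f.
Local Notation U := (tUotimes L).
Local Notation t := (@tUotimes_in _ _ _ _ L).
Local Notation D := (dlie_D L).
Implicit Types (u v : L) (a b : A) (c : k).

Definition tUotimes_proj : {rmorphism freealg k L -> U} :=
  qproj (@commutator_rel _ _ _ _ L) \o qproj (@J1_rel _ _ _ _ L)
    \o qproj (@multilinear_rel _ _ i L).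
Local Notation Q := tUotimes_proj.

Lemma tUotimes_in_proj u : t u = Q (fa_gen k u). Proof. by []. Qed.

Lemma tUotimes_multilinear p : multilinear_rel i p -> Q p = 0.
Proof. by move=> /qproj_eq0 Qp; rewrite /tUotimes_proj /= Qp !rmorph0. Qed.

Lemma tUotimes_J1 x : @J1_rel _ _ _ _ L x ->
  qproj (@commutator_rel _ _ _ _ L) (qproj (@J1_rel _ _ _ _ L) x) = 0.
Proof. by move=> /qproj_eq0 ->; rewrite rmorph0. Qed.

Lemma tUotimes_inD u v : t (u + v) = t u + t v.
Proof.
apply/eqP; rewrite -subr_eq0 opprD addrA !tUotimes_in_proj -!rmorphB; apply/eqP.
by apply: tUotimes_multilinear; left; exists u => //; exists v.
Qed.

Lemma tUotimes_inD1 : t D = 1.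
Proof.
have /tUotimes_J1 : @J1_rel _ _ _ _ L (tensor_in i D - 1) by left; left.
by rewrite !rmorphB !rmorph1 => /eqP; rewrite subr_eq0 => /eqP.
Qed.

Lemma tUotimes_inZ a u : t (a *: u) = t (a *: D) * t u.
Proof.
have /tUotimes_J1 : @J1_rel _ _ _ _ L
    (tensor_in i (a *: u) - tensor_in i (a *: D) * tensor_in i u).
  by left; right; exists a => //; exists u.
by rewrite !rmorphB !rmorphM => /eqP; rewrite subr_eq0 => /eqP.
Qed.

Lemma tUotimes_in_ract v b : t (ract v b) = t v * t (b *: D).
Proof.
have /tUotimes_J1 : @J1_rel _ _ _ _ L
    (tensor_in i (ract v b) - tensor_in i v * tensor_in i (b *: D)).
  by right; exists b => //; exists v.
by rewrite !rmorphB !rmorphM => /eqP; rewrite subr_eq0 => /eqP.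
Qed.

Lemma tUotimes_in_lie u v : t u * t v - t v * t u = t (lie u v).
Proof.
have /qproj_eq0 : @commutator_rel _ _ _ _ L (Uotimes_in u * Uotimes_in v
    - Uotimes_in v * Uotimes_in u - Uotimes_in (lie u v)).
  by exists u => //; exists v.
by rewrite !rmorphB !rmorphM => /eqP; rewrite subr_eq0 => /eqP.
Qed.

(** The relations [D = 1] and [au = (aD) u] make this a ring morphism from [A], the coefficient map
    of the basis theorem. *)
Definition tUotimes_coef a : U := t (a *: D).

Lemma tUotimes_coef_zmod : zmod_morphism tUotimes_coef.
Proof.
move=> a b; apply/eqP; rewrite eq_sym subr_eq -tUotimes_inD -scalerDl.
by rewrite subrK.
Qed.
Lemma tUotimes_coef_monoid : monoid_morphism tUotimes_coef.
Proof.
split=> [|a b]; first by rewrite /tUotimes_coef scale1r tUotimes_inD1.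
by rewrite /tUotimes_coef -scalerA tUotimes_inZ.
Qed.
HB.instance Definition _ :=
  GRing.isZmodMorphism.Build A U tUotimes_coef tUotimes_coef_zmod.
HB.instance Definition _ :=
  GRing.isMonoidMorphism.Build A U tUotimes_coef tUotimes_coef_monoid.
Local Notation phi := tUotimes_coef.

(** By [k]-multilinearity the formal multiple of the generator [D] by [c] agrees with the generator
    [i c *: D], and [D] becomes 1. *)
Lemma tUotimes_projZ c p : Q (c *: p) = phi (i c) * Q p.
Proof.
have -> : phi (i c) = Q (c *: fa_gen k D).
  apply/eqP; rewrite -subr_eq0 /tUotimes_coef tUotimes_in_proj -rmorphB; apply/eqP.
  by apply: tUotimes_multilinear; right; exists c => //; exists D.
rewrite -[p in LHS]mul1r -[fa_gen k D]mul1r !fa_scaleAl !rmorphM.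
by rewrite -tUotimes_in_proj tUotimes_inD1 mulr1.
Qed.

Lemma tUotimes_proj_surj x : exists p, x = Q p.
Proof.
exists (repr (repr (repr x))).
by rewrite /tUotimes_proj /= !qreprK.
Qed.

Lemma tUotimes_proj_word w :
  Q (wordprod (@fa_gen k L) w) = wordprod t w.
Proof. by rewrite rmorph_prod. Qed.

(** No separate case for 0, 1 or coefficients is needed: each of them is the image of a multiple of
    [D]. *)
Lemma tUotimes_gen (P : U -> Prop) : (forall x y, P x -> P y -> P (x + y)) ->
  (forall x y, P x -> P y -> P (x * y)) -> (forall u, P (t u)) -> forall x, P x.
Proof.
move=> PD PM Pt x; have [p ->] := tUotimes_proj_surj x.
rewrite (fa_expand (undup_uniq _) (@fa_support_coef _ _ p)) rmorph_sum.
elim/big_rec: _ => [|w y _ Py]; first by rewrite -(rmorph0 phi); exact: Pt.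
apply: PD Py; rewrite tUotimes_projZ tUotimes_proj_word; apply: (PM); first exact: Pt.
by rewrite /wordprod; elim/big_rec: _ => [|u z _ Pz];
  [rewrite -tUotimes_inD1|apply: PM].
Qed.

(** Scalars from [k] are central because the two actions of [k] agree, and a commutator of
    generators is again a generator. *)
Lemma tUotimes_almost_normalizing_base : almost_normalizing (phi \o i) t.
Proof.
split=> [P PD PM _|u c|u v]; first exact: tUotimes_gen.
- exists 0; rewrite rmorph0; apply/eqP; rewrite subr_eq0; apply/eqP.
  by rewrite /= -tUotimes_in_ract ract_base tUotimes_inZ.
- rewrite tUotimes_in_lie -[t _]mul1r -(rmorph1 (phi \o i)).
  exact: wordspan_letter.
Qed.

(** Coefficients must come from [k] here: a scalar [a] of [A] enters as the generator [t (a *: D)]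
    and counts in degree one. *)
Lemma tUotimes_filE n : @tUotimes_fil _ _ _ _ L n = wordfil (phi \o i) t n.+1.
Proof.
apply/seteqP; split=> [_ [_ [p /= pn <-] <-]|].
  rewrite -[X in wordfil _ _ _ X]/(Q p).
  rewrite (fa_expand (undup_uniq _) (@fa_support_coef _ _ p)) rmorph_sum.
  elim/big_rec: _ => [|w y _]; first exact: wordspan0.
  rewrite tUotimes_projZ tUotimes_proj_word.
  have [wn|nw] := leqP (size w) n; first exact: wordspanD.
  by rewrite pn // !rmorph0 mul0r add0r.
suff Qn x : wordfil (phi \o i) t n.+1 x -> exists2 p, Q p = x &
    forall w, (n < size w)%N -> fa_coef p w = 0.
  by move=> x /Qn[p <- pn]; exists (qproj (@multilinear_rel _ _ i L) p) => //; exists p.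
move: x; apply: wordspan_elim => [|_ _ [p <- pn] [q <- qn]|c w /= wn].
- by exists 0; rewrite ?rmorph0.
- exists (p + q) => [|w nw]; first by rewrite rmorphD.
  by rewrite fa_coefD pn // qn // addr0.
- exists (c *: wordprod (@fa_gen k L) w) => [|v nv].
    by rewrite -[LHS]/(Q _) tUotimes_projZ tUotimes_proj_word.
  rewrite fa_coefZ fa_coef_word; case: eqP nv => [->|_]; last by rewrite mulr0.
  by rewrite ltnNge -ltnS wn.
Qed.

Lemma tUotimes_almost_commutative : almost_commutative (@tUotimes_fil _ _ _ _ L).
Proof.
rewrite (_ : @tUotimes_fil _ _ _ _ L = fun n => wordfil (phi \o i) t n.+1).
  exact: wordfil_almost_commutative tUotimes_almost_normalizing_base.
by apply/funext => n; exact: tUotimes_filE.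
Qed.

(** Coefficients are now taken in [A], so the images of finitely many [A]-module generators suffice
    as letters. *)
Lemma tUotimes_noetherian : left_noetherian A -> fin_gen L -> noetherian U.
Proof.
move=> nA [n [g gL]].
pose tg j := t (g j).
have tgP u : exists c : 'I_n -> A, t u = \sum_j phi (c j) * tg j.
  have [c ->] := gL u; exists c.
  have t0 : t 0 = 0 by rewrite -(scale0r D); exact: (rmorph0 phi).
  by rewrite (big_morph _ tUotimes_inD t0); apply: eq_bigr => j _; exact: tUotimes_inZ.
apply: (@hilbert_basis _ _ phi _ tg) => //; split=> [P PD PM Pphi Pg|j a|j l].
- apply: tUotimes_gen => // u; have [c ->] := tgP u.
  by elim/big_rec: _ => [|j y _ Py]; [rewrite -(rmorph0 phi)|apply/PD/Py/PM].
(* This is the rule [uc = cu + pi(u)(c) D] read in the enveloping ring. *)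
- exists (dlie_pi (g j) a); apply/eqP; rewrite subr_eq; apply/eqP.
  rewrite -tUotimes_in_ract dlie_ract tUotimes_inD addrC.
  by congr (_ + _); exact: tUotimes_inZ.
- rewrite tUotimes_in_lie; have [c ->] := tgP (lie (g j) (g l)).
  elim/big_rec: _ => [|m y _ Fy]; first exact: wordspan0.
  by apply: wordspan_add Fy; exact: wordspan_letter.
Qed.

(** A map on the free algebra descends through the three quotients in turn, the conditions on [g]
    killing the respective relations. *)
Lemma tUotimes_lift (S : pzRingType) (psi : {rmorphism A -> S}) (g : L -> S) :
  (forall c s, psi (i c) * s = s * psi (i c)) ->
  {morph g : u v / u + v} -> g D = 1 ->
  (forall a u, g (a *: u) = psi a * g u) ->
  (forall u a, g (ract u a) = g u * psi a) ->
  (forall u v, g (lie u v) = g u * g v - g v * g u) ->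
  exists T : {rmorphism U -> S}, forall u, T (t u) = g u.
Proof.
move=> psiC gD g1 gZ gR gL.
have [h [hg hZ]] := @fa_lift k L S (psi \o i) g psiC.
have [|h1 h1E] := @quotring_lift _ _ (@multilinear_rel _ _ i L) h.
  move=> _ [[u _ [v _ <-]]|[c _ [u _ <-]]].
    by rewrite !rmorphB /= !hg gD addrAC addrK subrr.
  by rewrite rmorphB /= hZ !hg gZ subrr.
have [|h2 h2E] := @quotring_lift _ _ (@J1_rel _ _ _ _ L) h1.
  move=> x [[->|[a _ [u _ <-]]]|[b _ [v _ <-]]].
  - by rewrite rmorphB rmorph1 h1E hg g1 subrr.
  - by rewrite rmorphB rmorphM !h1E !hg !gZ g1 mulr1 subrr.
  - by rewrite rmorphB rmorphM !h1E !hg gR gZ g1 mulr1 subrr.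
have [|h3 h3E] := @quotring_lift _ _ (@commutator_rel _ _ _ _ L) h2.
  move=> _ [u _ [v _ <-]].
  by rewrite !rmorphB !rmorphM /Uotimes_in !h2E !h1E !hg gL subrr.
by exists h3 => u; rewrite h3E h2E h1E hg.
Qed.

End EnvelopingTheory.

(** * The action of End(L, E) on E *)

Section ActionOnE.
Variables (k A : comPzRingType) (i : {rmorphism k -> A}) (f : cocycle2 i).
Variables (L : dlie f) (E : lmodType A) (rho : connection L E).
Hypothesis rhoD : rho (dlie_D L) = 1.
Implicit Types (x y : EndL rhoD) (a : A).

Definition EndL_rho x : endk i E := (x.1 : endk i E) + rho x.2.

(** The [A]-linear part commutes with scalars, and the connection part contributes its symbol
    because [rho(D)] is the identity. The commutator is thus a scalar, so the operator has order at
    most one. *)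
Lemma EndL_rho_com x a :
  lie (EndL_rho x) (scal_id i E a) = scal_id i E (EndL_pi x a).
Proof. by rewrite /EndL_rho lieDl com_enda add0r (com_conn rhoD). Qed.

Lemma EndL_rho_diff1 x : EndL_rho x \in diff1_pred (i:=i) (E:=E).
Proof.
rewrite unfold_in; apply/asboolP/diff_op1P => a b.
by rewrite EndL_rho_com com_scal.
Qed.

Definition EndL_diff1 x : diff1 i E := Diff1 (EndL_rho_diff1 x).

Lemma EndL_rhoD x y : EndL_rho (x + y) = EndL_rho x + EndL_rho y.
Proof. by rewrite /EndL_rho connD addrACA. Qed.

Lemma EndL_rhoZ a x : EndL_rho (a *: x) = a *: EndL_rho x.
Proof. by rewrite /EndL_rho connZ scalerDr. Qed.

Lemma EndL_rho_ract x a : EndL_rho (ract x a) = ract (EndL_rho x) a.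
Proof.
by rewrite /EndL_rho (ractDl a (x.1 : endk i E)) -(conn_hom rho).2.
Qed.

(** The curvature term in the bracket compensates exactly the failure of [rho] to preserve
    brackets. *)
Lemma EndL_rho_lie x y : EndL_rho (lie x y) = lie (EndL_rho x) (EndL_rho y).
Proof.
rewrite /EndL_rho lieDl 2!lieDr [RHS]addrACA.
have -> : ((lie x y).1 : endk i E) = lie (x.1 : endk i E) y.1
  + lie (rho x.2) y.1 - lie (rho y.2) x.1 + curvature rho x.2 y.2 by [].
by rewrite -[LHS]addrA [curvature _ _ _ + _]subrK -endk_antiC addrA.
Qed.

Lemma EndL_diff1_bimod : bimod_hom EndL_diff1.
Proof.
split=> [a x y|x a]; apply: val_inj; last exact: EndL_rho_ract.
by rewrite /= EndL_rhoD EndL_rhoZ.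
Qed.

Lemma scal_id_diff a : scal_id i E a \in diff_pred (i:=i) (E:=E).
Proof.
rewrite unfold_in; apply/asboolP; exists 0%N; apply/diff_op0P => b.
exact: com_scal.
Qed.
Definition scal_diff a : diff i E := Diff (scal_id_diff a).

Lemma scal_diff_zmod : zmod_morphism scal_diff.
Proof. by move=> a b; apply: val_inj; rewrite /= scal_idD scal_idN. Qed.
Lemma scal_diff_monoid : monoid_morphism scal_diff.
Proof.
split=> [|a b]; apply: val_inj; first exact: scale1r.
by apply: endk_ext => e; exact: esym (scalerA a b e).
Qed.
HB.instance Definition _ :=
  GRing.isZmodMorphism.Build A (diff i E) scal_diff scal_diff_zmod.
HB.instance Definition _ :=
  GRing.isMonoidMorphism.Build A (diff i E) scal_diff scal_diff_monoid.

Lemma EndL_rho_diff x : EndL_rho x \in diff_pred (i:=i) (E:=E).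
Proof.
have := EndL_rho_diff1 x; rewrite !unfold_in => /asboolP h.
by apply/asboolP; exists 1%N.
Qed.
Definition EndL_diff x : diff i E := Diff (EndL_rho_diff x).

(** [A] acts by scalar operators, and the image of [k] is central since differential operators are
    [k]-linear. *)
Lemma EndL_action : exists T : {rmorphism tUotimes (EndL_dlie rhoD) -> diff i E},
  forall x : EndL_dlie rhoD, T (tUotimes_in x) = EndL_diff x.
Proof.
apply: (@tUotimes_lift _ _ _ _ _ _ scal_diff) => [c s|x y||a x|x a|x y]; apply: val_inj.
- by apply: endk_ext => e; exact: esym (endk_base (diff_val s) c e).
- exact: EndL_rhoD.
- by rewrite /= /EndL_rho /= add0r.
- by rewrite /= EndL_rhoZ scal_idM.
- exact: EndL_rho_ract.
- exact: EndL_rho_lie.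
Qed.

Lemma fin_gen_EndL : left_noetherian A -> fin_gen L -> fin_gen E ->
  fin_gen (EndL rhoD).
Proof. by move=> nA Lfg Efg; apply: fin_gen_pair => //; exact: fin_gen_enda. Qed.

End ActionOnE.

(** * Kernels, images and image filtrations of ring morphisms *)

Lemma corestr_range (R S : pzRingType) (h : {rmorphism R -> S}) :
  range (corestr h) = setT.
Proof.
apply/seteqP; split=> // -[y hy] _; have := hy; rewrite unfold_in.
by move=> /asboolP[x _ xy]; exists x => //; apply: val_inj.
Qed.

Lemma ker_corestr_exact (R S : pzRingType) (h : {rmorphism R -> S}) :
  short_exact (@ker_val _ _ h) (corestr h).
Proof.
split; [exact: val_inj| |exact: corestr_range].
apply/seteqP; split=> [_ [x _ <-]|x /(congr1 (@im_val _ _ h)) /= hx].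
  by apply: val_inj => /=; apply/eqP; exact: (valP x).
have kx : x \in ker_pred h by rewrite unfold_in; apply/eqP.
by exists (RingKer kx).
Qed.

Lemma almost_commutative_image (R S : pzRingType) (h : {rmorphism R -> S})
    (F : nat -> set R) : range h = setT ->
  almost_commutative F -> almost_commutative (fun n => h @` F n).
Proof.
move=> hT [[F0 F1 FS FM FT] Fcom]; split; last first.
  move=> m n _ _ [x Fx <-] [y Fy <-]; have := Fcom m n x y Fx Fy.
  case: (m + n)%N => [|p] xy; last first.
    by exists (x * y - y * x); rewrite // rmorphB !rmorphM.
  by rewrite -!rmorphM -rmorphB xy rmorph0.
split=> [n|||m n _ _ [x Fx <-] [y Fy <-]|].
- have [Fn0 FnB] := F0 n; split; first by exists 0; rewrite ?rmorph0.
  by move=> _ _ [x Fx <-] [y Fy <-]; exists (x - y); rewrite ?rmorphB //; exact: FnB.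
- by exists 1; rewrite ?rmorph1.
- by move=> n _ [x Fx <-]; exists x => //; exact: FS.
- by exists (x * y); rewrite ?rmorphM //; exact: FM.
- apply/seteqP; split=> // y _; have [x _ <-] : range h y by rewrite hT.
  by have [n _ Fx] : (\bigcup_n F n) x; [rewrite FT|exists n => //; exists x].
Qed.

(** Brackets are compared in [endk], where commutators exist, and uniqueness of [T] expresses that
    it is the map induced by [rho']. *)
Theorem theorem1p3 (k A : comPzRingType) (i : {rmorphism k -> A})
    (f : cocycle2 i) (L : dlie f) (E : lmodType A) (rho : connection L E)
    (rhoD : rho (dlie_D L) = 1) :
  let EL := EndL_dlie rhoD in
  exists rho' : EndL rhoD -> diff1 i E,
  [/\ forall (phi : enda i E) (u : L),
        rho' (phi, u) = (phi : endk i E) + rho u :> endk i E,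
      bimod_hom rho',
      lie_hom (fun x => rho' x : endk i E)
    & exists T : {rmorphism tUotimes EL -> diff i E},
      let fil_EL := @tUotimes_fil _ _ _ _ EL in
      let fil_im n := corestr T @` fil_EL n in
      [/\ forall x : EL, T (tUotimes_in x) = rho' x :> endk i E,
          forall T' : {rmorphism tUotimes EL -> diff i E},
            (forall x : EL, T' (tUotimes_in x) = rho' x :> endk i E) -> T' =1 T,
          short_exact (@ker_val _ _ T) (corestr T),
          almost_commutative fil_EL /\ almost_commutative fil_im
        & noetherian A -> fin_gen L -> fin_gen E ->
            noetherian (tUotimes EL) /\ noetherian (ring_im T)]].
Proof.
move=> EL; exists (@EndL_diff1 _ _ _ _ _ _ _ rhoD); split=> //.
- exact: EndL_diff1_bimod.
- exact: EndL_rho_lie.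
have [T TE] := EndL_action rhoD; exists T => fil_EL fil_im.
have acEL : almost_commutative fil_EL by exact: tUotimes_almost_commutative.
split=> [x|T' T'E x|||[nA _] Lfg Efg].
- by rewrite TE.
- move: x; apply: tUotimes_gen => [x y ex ey|x y ex ey|x].
  + by rewrite !rmorphD ex ey.
  + by rewrite !rmorphM ex ey.
  + by apply: val_inj; rewrite TE; exact: T'E.
- exact: ker_corestr_exact.
- split=> //; apply: almost_commutative_image acEL; exact: corestr_range.
have nEL : noetherian (tUotimes EL).
  apply: tUotimes_noetherian => //; exact: fin_gen_EndL.
by split=> //; apply: noetherian_image nEL; exact: corestr_range.
Qed.
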